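(* Let $n\ge2$, let $\lambda$ be a weight of $sl(n)$ with $\lambda(h_i)=\lambda_i$ for $i=1,\dots,n-1$, and let $M_\lambda$ be the corresponding Verma module. With $\tau$ and $\theta_{\vec i}$ as defined in the context: (1) $M_\lambda$ has at most $n!$ singular vectors up to scalar multiples. (2) Every singular vector of $M_\lambda$ is, up to a scalar multiple, of the form $\tau^{-1}(\theta_{\vec i})$ for some $\vec i=(i_1,\dots,i_{n-1})\in\mathbb{N}^{n-1}$ with $i_p\le p$ for which $\theta_{\vec i}$ is a polynomial. (3) $M_\lambda$ has exactly $n!$ singular vectors up to scalar multiples if and only if $\lambda$ is a dominant integral weight, that is, $\lambda_i\in\mathbb{N}$ for $i=1,2,\dots,n-1$. In this case, $\{\tau^{-1}(\theta_{\vec i})\mid \vec i=(i_1,\dots,i_{n-1})\in\mathbb{N}^{n-1},\ i_p\le p\}$ are all the singular vectors up to scalar multiples.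
   Context: All vector spaces are over $\mathbb{C}$; $\mathbb{N}=\{0,1,2,\dots\}$. $E_{i,j}$ is the $n\times n$ matrix unit, $h_i=E_{i,i}-E_{i+1,i+1}$, $H=\sum_{i=1}^{n-1}\mathbb{C}h_i$; positive root vectors are $E_{i,j}$, $i<j$. For $\alpha=(\alpha_{i,j})_{1\le j<i\le n}$ with $\alpha_{i,j}\in\mathbb{N}$ put, in $U(sl(n))$, $$E^\alpha=E_{2,1}^{\alpha_{2,1}}E_{3,1}^{\alpha_{3,1}}E_{3,2}^{\alpha_{3,2}}E_{4,1}^{\alpha_{4,1}}\cdots E_{n,1}^{\alpha_{n,1}}\cdots E_{n,n-1}^{\alpha_{n,n-1}}.$$ $M_\lambda$ is the Verma module with highest weight vector $v_\lambda$ of weight $\lambda$, with basis $\{E^\alpha v_\lambda\}$. A singular vector is a nonzero $H$-weight vector $u\in M_\lambda$ with $E_{i,i+1}(u)=0$ for $i=1,\dots,n-1$. Let $\mathcal{A}=\mathbb{C}[x_{i,j}\mid1\le j<i\le n]$ and let $\tau:M_\lambda\to\mathcal{A}$ be the linear isomorphism $\tau(E^\alpha v_\lambda)=x^\alpha=\prod x_{i,j}^{\alpha_{i,j}}$. Write $\partial_{i,j}=\partial/\partial x_{i,j}$. The space $\mathcal{A}_1\supset\mathcal{A}$: let $\mathcal{A}_0=\mathbb{C}[x_{i,j}\mid 1\le j\le i-2\le n-2]$, and for $\vec\mu\in\mathbb{C}^{n-1}$ let $x^{\vec\mu}=\prod_{i=1}^{n-1}x_{i+1,i}^{\mu_i}$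 (formal complex powers). Then $$\mathcal{A}_1=\Big\{\sum_{\vec j\in\mathbb{N}^{n-1}}\sum_{i=1}^p f_{\vec\mu^i-\vec j}\,x^{\vec\mu^i-\vec j}\ \Big|\ 1\le p\in\mathbb{N},\ \vec\mu^i\in\mathbb{C}^{n-1},\ f_{\vec\mu^i-\vec j}\in\mathcal{A}_0\Big\},$$ with differential operators acting termwise by the usual rules. ''Polynomial'' means an element of $\mathcal{A}$. For $\mu\in\mathbb{C}$, $p\in\mathbb{N}$ let $\langle\mu\rangle_p=\mu(\mu-1)\cdots(\mu-p+1)$ (with $\langle\mu\rangle_0=1$). For $1\le i\le n-1$ and $\mu\in\mathbb{C}$ define the operator on $\mathcal{A}_1$ $$\eta_i^\mu=\sum_{p=0}^\infty\frac{\langle\mu\rangle_p}{p!}x_{i+1,i}^{\mu-p}\Big(\sum_{j=1}^{i-1}x_{i+1,j}\partial_{i,j}\Big)^p.$$ Definition of $\theta_{\vec i}$ for $\vec i=(i_1,\dots,i_{n-1})\in\mathbb{N}^{n-1}$ with $i_p\le p$: set $\lambda_j^{(n-1)}=\lambda_j$ for $1\le j\le n-1$. For $p=n-1,n-2,\dots,2$ define inductively, for $1\le j\le p-1$: if $i_p=0$, $\lambda_j^{(p-1)}=\lambda_j^{(p)}$; if $i_p\ge1$, $$\lambda_j^{(p-1)}=\begin{cases}\lambda_j^{(p)}& j<i_p-1,\\ \lambda^{(p)}_{i_p}+\lambda^{(p)}_{i_p-1}+1& j=i_p-1,\\ \lambda_{j+1}^{(p)}& j\ge i_p.\end{cases}$$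 For $1\le p\le n-1$ let $B_p=1$ (identity) if $i_p=0$, and if $i_p\ge1$ let $$B_p=\eta_p^{e_{p,p}}\,\eta_{p-1}^{e_{p,p-1}}\cdots\eta_{i_p}^{e_{p,i_p}},\qquad e_{p,k}=(k-i_p+1)+\sum_{r=i_p}^{k}\lambda_r^{(p)}\quad(i_p\le k\le p).$$ Then $\theta_{\vec i}=B_1B_2\cdots B_{n-1}(1)$, the product of operators applied to the constant function $1$. *)

(* Defs.v *)
From HB Require Import structures.
From mathcomp Require Import all_boot all_order all_algebra.
From mathcomp Require Import all_classical reals.
From mathcomp Require Import complex.
From mathcomp Require Import mpoly zify.
Set Implicit Arguments.
Unset Strict Implicit.
Unset Printing Implicit Defensive.
Import Order.TTheory GRing.Theory Num.Theory.
Local Open Scope classical_set_scope.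
Local Open Scope ring_scope.

(* Indices are 1-based naturals throughout, as in E_{i,j} with 1 <= i, j <= n. *)

Definition mxunit (C : nzRingType) (n i j : nat) : 'M[C]_n :=
  \matrix_(a < n, b < n) ((a.+1 == i) && (b.+1 == j))%:R.

Definition hmx (C : nzRingType) (n i : nat) : 'M[C]_n :=
  mxunit C n i i - mxunit C n i.+1 i.+1.

(* Only the values of [act] on traceless matrices are meaningful. *)
Record sl_module (C : fieldType) (n : nat) (M : lmodType C)
    (act : 'M[C]_n -> M -> M) : Prop := SlModule {
  sl_linear_vec : forall X, \tr X = 0 -> linear (act X);
  sl_linear_mx : forall (a : C) X Y u, \tr X = 0 -> \tr Y = 0 ->
    act (a *: X + Y) u = a *: act X u + act Y u;
  sl_bracket : forall X Y u, \tr X = 0 -> \tr Y = 0 ->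
    act (X *m Y - Y *m X) u = act X (act Y u) - act Y (act X u) }.

(* A weight is given by its values mu_1, ..., mu_{n-1} on the basis h_i of H;
   the other values of [mu] are irrelevant. *)
Definition weight_vector (C : fieldType) (n : nat) (M : lmodType C)
    (act : 'M[C]_n -> M -> M) (mu : nat -> C) (u : M) : Prop :=
  forall i, (0 < i < n)%N -> act (hmx C n i) u = mu i *: u.

Definition singular_vector (C : fieldType) (n : nat) (M : lmodType C)
    (act : 'M[C]_n -> M -> M) (u : M) : Prop :=
  [/\ u != 0, exists mu : nat -> C, weight_vector act mu u
    & forall i, (0 < i < n)%N -> act (mxunit C n i i.+1) u = 0].

(* The positions (2,1), (3,1), (3,2), (4,1), ..., (n,n-1), in the order of the
   factors of E^alpha. *)
Definition lowpos (n : nat) : seq (nat * nat) :=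
  [seq (i, j) | i <- iota 2 n.-1, j <- iota 1 i.-1].

(* The ring A = C[x_{i,j} | 1 <= j < i <= n]: the variable 'X_k stands for
   x_{i,j} with (i, j) the k-th element of [lowpos n]. *)
Notation polyA C n := {mpoly C[size (lowpos n)]}.

(* The component alpha_{i,j}; it is 0 if (i, j) is not in [lowpos n]. *)
Definition mexp (n : nat) (alpha : 'X_{1..size (lowpos n)}) (i j : nat) : nat :=
  nth 0%N alpha (index (i, j) (lowpos n)).

(* E^alpha u, the rightmost factor of E^alpha acting first *)
Definition Epow (C : fieldType) (n : nat) (M : lmodType C)
    (act : 'M[C]_n -> M -> M) (alpha : 'X_{1..size (lowpos n)}) (u : M) : M :=
  foldr (fun ij w => iter (mexp alpha ij.1 ij.2) (act (mxunit C n ij.1 ij.2)) w)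
    u (lowpos n).

(* The last field says that (E^alpha v)_alpha is a basis of M: a family of
   coefficients with finite support is the same thing as an element of A.  By the
   PBW theorem this determines the Verma module up to isomorphism. *)
Record verma_module (C : fieldType) (n : nat) (lam : nat -> C) (M : lmodType C)
    (act : 'M[C]_n -> M -> M) (v : M) : Prop := VermaModule {
  verma_sl : sl_module act;
  verma_weight : weight_vector act lam v;
  verma_highest : forall i j, (0 < i < j)%N -> (j <= n)%N ->
    act (mxunit C n i j) v = 0;
  verma_basis : forall u : M, exists! q : polyA C n,
    u = \sum_(alpha <- msupp q) q@_alpha *: Epow act alpha v }.

Definition line (C : fieldType) (M : lmodType C) (u : M) : set M :=
  [set c *: u | c in [set: C]].

Definition singular_lines (C : fieldType) (n : nat) (M : lmodType C)
    (act : 'M[C]_n -> M -> M) : set (set M) :=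
  [set line u | u in singular_vector act].

(* [e i j] is the exponent of x_{i,j}. *)
Definition expo (C : Type) := nat -> nat -> C.

(* A formal sum of monomials x^e, given by the coefficients of the x^e *)
Definition series (C : Type) := expo C -> C.

(* The exponent of x^e * x_{i,j}^c *)
Definition shift (C : nzRingType) (i j : nat) (c : C) (e : expo C) : expo C :=
  fun a b => if (a == i) && (b == j) then e a b + c else e a b.

Definition monomial (C : nzRingType) (e0 : expo C) : series C :=
  fun e => (`[< e = e0 >])%:R.

Definition one_series (C : nzRingType) : series C :=
  monomial (fun _ _ => 0).

Definition series_of_poly (C : nzRingType) (n : nat) (q : polyA C n) :
    series C :=
  fun e => \sum_(alpha <- msupp q)
    q@_alpha * monomial (fun i j => (mexp alpha i j)%:R) e.

(* Membership in A_1. The first condition says that the exponents that occur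
   are those of A_0-monomials times x^(mu^q - d) with d in N^(n-1); the second
   one that the coefficient of each x^nu is a polynomial, not a power series. *)
Definition A1_exponents (C : nzRingType) (n p : nat) (mu : 'I_p -> nat -> C)
    (f : series C) : Prop :=
  forall e, f e != 0 ->
    [/\ forall i j, (i, j) \notin lowpos n -> e i j = 0,
        forall i j, (j.+1 < i)%N -> exists d : nat, e i j = d%:R
      & exists q : 'I_p, forall k, (0 < k < n)%N ->
          exists d : nat, e k.+1 k = mu q k - d%:R].

Definition A1_coefficients (C : nzRingType) (n : nat) (f : series C) : Prop :=
  forall nu : nat -> C,
    finite_set [set e | f e != 0 /\ forall k, (0 < k < n)%N -> e k.+1 k = nu k].

Definition in_A1 (C : nzRingType) (n : nat) (f : series C) : Prop :=
  (exists (p : nat) (mu : 'I_p -> nat -> C), (0 < p)%N /\ A1_exponents n mu f)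
  /\ A1_coefficients n f.

(* x^e * x_{i,j}^c = x^(shift i j c e), so the coefficients move the other way. *)
Definition mulX (C : nzRingType) (i j : nat) (c : C) (f : series C) :
    series C :=
  fun e => f (shift i j (- c) e).

Definition partialX (C : nzRingType) (i j : nat) (f : series C) : series C :=
  fun e => (e i j + 1) * f (shift i j 1 e).

Definition falling (C : nzRingType) (mu : C) (p : nat) : C :=
  \prod_(r < p) (mu - r%:R).

(* The operator \sum_(1 <= j < i) x_{i+1,j} d/dx_{i,j} *)
Definition Dop (C : nzRingType) (i : nat) (f : series C) : series C :=
  fun e => \sum_(1 <= j < i) mulX i.+1 j 1 (partialX i j f) e.

Definition eta_term (C : fieldType) (i : nat) (mu : C) (f : series C)
    (p : nat) : series C :=
  fun e => falling mu p / p`!%:R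
           * mulX i.+1 i (mu - p%:R) (iter p (Dop i) f) e.

(* The infinite sum is taken coefficientwise. On A_1 every coefficient of it is
   a finite sum, and the result is in A_1: see [eta_summable] and [eta_A1]. *)
Definition eta (C : fieldType) (i : nat) (mu : C) (f : series C) : series C :=
  fun e => \sum_(p \in [set: nat]) eta_term i mu f p e.

(* From lambda^(p) to lambda^(p-1), where ip is i_p *)
Definition lam_step (C : nzRingType) (ip : nat) (l : nat -> C) : nat -> C :=
  fun j =>
    if ip == 0%N then l j
    else if (j < ip.-1)%N then l j
    else if j == ip.-1 then l ip + l ip.-1 + 1
    else l j.+1.

(* lambda^(n-1-d) *)
Fixpoint lam_down (C : nzRingType) (n : nat) (lam : nat -> C) (idx : nat -> nat)
    (d : nat) : nat -> C :=
  if d is d'.+1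
  then lam_step (idx (n.-1 - d')%N) (lam_down n lam idx d')
  else lam.

(* lambda^(p) *)
Definition lam_at (C : nzRingType) (n : nat) (lam : nat -> C) (idx : nat -> nat)
    (p : nat) : nat -> C :=
  lam_down n lam idx (n.-1 - p).

(* e_{p,k}, for 1 <= i_p <= k <= p *)
Definition theta_exp (C : nzRingType) (n : nat) (lam : nat -> C)
    (idx : nat -> nat) (p k : nat) : C :=
  (k - idx p + 1)%N%:R + \sum_(idx p <= r < k.+1) lam_at n lam idx p r.

(* B_p; the factor with k = i_p is applied first. *)
Definition Bop (C : fieldType) (n : nat) (lam : nat -> C) (idx : nat -> nat)
    (p : nat) (f : series C) : series C :=
  if idx p == 0%N then f
  else foldl (fun g k => eta k (theta_exp n lam idx p k) g) f
         (iota (idx p) (p.+1 - idx p)).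

Definition theta (C : fieldType) (n : nat) (lam : nat -> C)
    (idx : nat -> nat) : series C :=
  foldr (Bop n lam idx) (@one_series C) (iota 1 n.-1).

(* Only idx 1, ..., idx (n-1) matter. *)
Definition admissible (n : nat) (idx : nat -> nat) : Prop :=
  forall p, (0 < p < n)%N -> (idx p <= p)%N.

Definition dominant_integral (C : nzRingType) (n : nat) (lam : nat -> C) :
    Prop :=
  forall i, (0 < i < n)%N -> exists k : nat, lam i = k%:R.

Lemma mem_lowpos n i j :
  ((i, j) \in lowpos n) = [&& (0 < j)%N, (j < i)%N & (i <= n)%N].
Proof.
apply/allpairsPdep/idP => [[a [b []]]|/and3P[j0 ji iN]].
  rewrite !mem_iota => /andP[a2 an] /andP[b1 ba] [-> ->].
  by apply/and3P; split; lia.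
by exists i, j; rewrite !mem_iota; split => //; lia.
Qed.

Lemma shiftK (C : nzRingType) i j (c : C) : cancel (shift i j (- c)) (shift i j c).
Proof.
move=> e; apply/funext => a; apply/funext => b; rewrite /shift.
by case: (_ && _); rewrite ?subrK.
Qed.

Lemma finite_shift (C : nzRingType) i j (c : C) (A : set (expo C)) :
  finite_set A -> finite_set [set e | A (shift i j c e)].
Proof.
move=> fA; apply: sub_finite_set (finite_image (shift i j (- c)) fA).
move=> e /= Ae; exists (shift i j c e) => //.
by have := shiftK i j (- c) e; rewrite opprK.
Qed.

Lemma A1_mulX (C : numFieldType) n p (mu mu' : 'I_p -> nat -> C) i j c f :
  (i, j) \in lowpos n ->
  ((j.+1 < i)%N -> exists d : nat, c = d%:R) ->
  (forall q k, mu' q k =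
     if (k.+1 == i) && (k == j) then mu q k + c else mu q k) ->
  A1_exponents n mu f -> A1_exponents n mu' (mulX i j c f).
Proof.
move=> ijn cN Hmu H e /H [H1 H2 [q H3]]; split.
- move=> a b abn; have := H1 a b abn; rewrite /shift; case: ifP => //.
  by case/andP=> /eqP ai /eqP bj; rewrite ai bj ijn in abn.
- move=> a b ab; have [d] := H2 a b ab; rewrite /shift; case: ifP.
    case/andP=> /eqP ai /eqP bj eab.
    have [|d' cd] := cN; first by rewrite -ai -bj.
    exists (d + d')%N; by rewrite natrD -eab cd subrK.
  by move=> _ ->; exists d.
- exists q => k kn; have [d] := H3 k kn; rewrite /shift Hmu; case: ifP.
    move=> _ /eqP; rewrite subr_eq => /eqP ->; exists d.
    by rewrite addrAC.
  by move=> _ ->; exists d.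
Qed.

Lemma A1_coeff_shift (C : numFieldType) n i j (c : C) (f g : series C) :
  (forall e, g e != 0 -> f (shift i j c e) != 0) ->
  A1_coefficients n f -> A1_coefficients n g.
Proof.
move=> gf H nu.
pose nu' := fun k => if (k.+1 == i) && (k == j) then nu k + c else nu k.
apply: sub_finite_set (@finite_shift _ i j c _ (H nu')).
move=> e /= [ge He]; split; first exact: gf.
by move=> k kn; rewrite /shift /nu'; case: ifP => _; rewrite He.
Qed.

Lemma A1_partial (C : numFieldType) n p (mu : 'I_p -> nat -> C) i j f :
  (i, j) \in lowpos n ->
  A1_exponents n mu f -> A1_exponents n mu (partialX i j f).
Proof.
move=> ijn H e; rewrite /partialX mulf_eq0 negb_or => /andP[eij /H].
move=> [H1 H2 [q H3]]; split.
- move=> a b abn; have := H1 a b abn; rewrite /shift; case: ifP => //.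
  by case/andP=> /eqP ai /eqP bj; rewrite ai bj ijn in abn.
- move=> a b ab; have [d] := H2 a b ab; rewrite /shift; case: ifP.
    case/andP=> /eqP -> /eqP -> eab.
    move: eij; rewrite eab; case: d eab => [|d] eab; first by rewrite eqxx.
    by move=> _; exists d; apply: (addIr 1); rewrite eab natr1.
  by move=> _ ->; exists d.
- exists q => k kn; have [d] := H3 k kn; rewrite /shift; case: ifP.
    move=> _ E; exists d.+1; apply: (addIr 1).
    by rewrite E -natr1 opprD addrA subrK.
  by move=> _ ->; exists d.
Qed.

Lemma fin_D (C : numFieldType) n i (f : series C) :
  A1_coefficients n f -> A1_coefficients n (Dop i f).
Proof.
move=> H nu.
pose T j := mulX i.+1 j 1 (partialX i j f).
have HT j : A1_coefficients n (T j).
  apply: (@A1_coeff_shift _ n i.+1 j (-1) (partialX i j f)) => //.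
  apply: (@A1_coeff_shift _ n i j 1 f) => //.
  by move=> e; rewrite /partialX mulf_eq0 negb_or => /andP[].
apply: (sub_finite_set (B := \bigcup_(j in `I_i)
   [set e | T j e != 0 /\ forall k, (0 < k < n)%N -> e k.+1 k = nu k])).
  move=> e /= [De He]; apply: contrapT => nex.
  move/negP: De; apply; apply/eqP; rewrite /Dop big_nat big1 // => j /andP[_ ji].
  by apply: contrapT => /eqP Tj; apply: nex; exists j.
by apply: bigcup_finite => // j _; exact: HT.
Qed.

Lemma A1_D (C : numFieldType) n p (mu : 'I_p -> nat -> C) i f :
  (0 < i < n)%N -> A1_exponents n mu f -> A1_exponents n mu (Dop i f).
Proof.
move=> ip H e De.
have [j ji Tj] : exists2 j, (0 < j < i)%N &
    mulX i.+1 j 1 (partialX i j f) e != 0.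
  apply: contrapT => nex; move/negP: De; apply; apply/eqP.
  rewrite /Dop big_nat big1 // => j ji.
  by apply: contrapT => /eqP Tj; apply: nex; exists j.
apply: (@A1_mulX _ n p mu mu i.+1 j 1 (partialX i j f) _ _ _ _ e Tj).
- by rewrite mem_lowpos; lia.
- by move=> _; exists 1%N.
- by move=> q k; case: ifP => // /andP[/eqP ? /eqP ?]; lia.
- by apply: A1_partial => //; rewrite mem_lowpos; lia.
Qed.

Lemma nat_bound (C : numFieldType) p (c : 'I_p -> C) :
  exists N, forall q d, c q = d%:R -> (d <= N)%N.
Proof.
exists (\sum_q xget 0%N [set d | c q = d%:R])%N => q d cd.
rewrite (bigD1 q) //=; apply: (leq_trans _ (leq_addr _ _)).
case: xgetP => [d' _ /= cd'|/(_ d)] //=.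
by move: cd; rewrite cd' => /eqP; rewrite eqr_nat => /eqP ->.
Qed.

Definition mu_plus (C : nzRingType) (p i : nat) (c : C) (mu : 'I_p -> nat -> C) :
    'I_p -> nat -> C :=
  fun q k => if k == i then mu q k + c else mu q k.

Lemma eta_term_shape (C : numFieldType) n p (mu : 'I_p -> nat -> C) i c f r :
  (0 < i < n)%N -> A1_exponents n mu f ->
  A1_exponents n (mu_plus i (c - r%:R) mu) (eta_term i c f r).
Proof.
move=> ip H e; rewrite /eta_term mulf_eq0 negb_or => /andP[_].
apply: (@A1_mulX _ n p mu).
- by rewrite mem_lowpos; lia.
- by rewrite ltnn.
- by move=> q k; rewrite /mu_plus eqSS andbb.
- by elim: r => //= r IH; apply: A1_D.
Qed.

Lemma eta_term_fin (C : numFieldType) n i c (f : series C) r :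
  A1_coefficients n f -> A1_coefficients n (eta_term i c f r).
Proof.
move=> H.
apply: (@A1_coeff_shift _ n i.+1 i (- (c - r%:R)) (iter r (Dop i) f)).
  by move=> e; rewrite /eta_term mulf_eq0 negb_or => /andP[].
by elim: r => //= r IH; apply: fin_D.
Qed.

Lemma eta_term_bound (C : numFieldType) n p (mu : 'I_p -> nat -> C) i c f x :
  (0 < i < n)%N -> A1_exponents n mu f ->
  exists N, forall e r, e i.+1 i = x -> eta_term i c f r e != 0 -> (r < N)%N.
Proof.
move=> ip H; have [N HN] := nat_bound (fun q => mu q i + c - x).
exists N.+1 => e r ex /(eta_term_shape ip H)[_ _ [q /(_ i ip)[d]]].
rewrite /mu_plus eqxx ex => xE; rewrite ltnS.
apply: leq_trans (leq_addl d r) _; apply: (HN q).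
rewrite xE natrD !addrA !opprD !opprK !addrA.
set m := mu q i.
by rewrite [m + c - m]addrAC subrr add0r subrr add0r addrC.
Qed.

Lemma eta_summable (C : numFieldType) n i (c : C) f e :
  (0 < i < n)%N -> in_A1 n f ->
  finite_set [set r | eta_term i c f r e != 0].
Proof.
move=> ip [[p [mu [_ H]]] _].
have [N HN] := eta_term_bound c (e i.+1 i) ip H.
by apply: (sub_finite_set (B := `I_N)) => // r /= /(HN e r erefl).
Qed.

Lemma eta_neq0 (C : numFieldType) i (c : C) f e :
  eta i c f e != 0 -> exists r, eta_term i c f r e != 0.
Proof.
move=> He; apply: contrapT => nex; move/negP: He; apply; apply/eqP.
rewrite /eta; apply: fsbig1 => r _.
by apply: contrapT => /eqP Hr; apply: nex; exists r.
Qed.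

Lemma eta_A1 (C : numFieldType) n i (c : C) f :
  (0 < i < n)%N -> in_A1 n f -> in_A1 n (eta i c f).
Proof.
move=> ip [[p [mu [p0 H]]] F]; split.
  exists p, (mu_plus i c mu); split => // e /eta_neq0[r].
  move=> /(eta_term_shape ip H)[H1 H2 [q H3]]; split => //.
  exists q => k kn; have [d] := H3 k kn; rewrite /mu_plus.
  case: ifP => _ ->; last by exists d.
  by exists (r + d)%N; rewrite natrD opprD !addrA.
move=> nu; have [N HN] := eta_term_bound c (nu i) ip H.
apply: (sub_finite_set (B := \bigcup_(r in `I_N) [set e |
  eta_term i c f r e != 0 /\ forall k, (0 < k < n)%N -> e k.+1 k = nu k])).
  move=> e /= [/eta_neq0[r Hr] He]; exists r => //=.
  by apply: HN Hr; exact: He.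
by apply: bigcup_finite => // r _; exact: eta_term_fin.
Qed.

Lemma one_A1 (C : numFieldType) n : in_A1 n (@one_series C).
Proof.
have E e : one_series e != 0 :> C -> e = fun _ _ => 0.
  by rewrite /one_series /monomial; case: asboolP; rewrite ?eqxx.
split.
  exists 1%N, (fun _ _ => 0); split=> // e /E ->; split => //.
    by move=> *; exists 0%N.
  by exists ord0 => k _; exists 0%N; rewrite subr0.
move=> nu; apply: sub_finite_set (finite_set1 (fun _ _ => 0)).
by move=> e /= [/E ->].
Qed.

Lemma theta_A1 (C : numFieldType) n (lam : nat -> C) idx :
  admissible n idx -> in_A1 n (theta n lam idx).
Proof.
move=> adm; rewrite /theta.
have : all (fun p => 0 < p < n)%N (iota 1 n.-1).
  by apply/allP => p; rewrite mem_iota; lia.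
elim: (iota 1 n.-1) => [_|p s IH /= /andP[pn /IH]]; first exact: one_A1.
set f := foldr _ _ _; move: f => f fA; rewrite /Bop; case: eqP => // ip0.
have : all (fun k => 0 < k < n)%N (iota (idx p) (p.+1 - idx p)).
  by apply/allP => k; rewrite mem_iota; have := adm p pn; lia.
elim: (iota _ _) f fA => [//|k t IHt] f fA /= /andP[kn]; apply: IHt.
exact: eta_A1.
Qed.

(* Main.v *)
(* Through tau, E_{i+1,i} acts on polynomials as x_{i+1,i} + D_i, where
   D_i = sum_(j < i) x_{i+1,j} d/dx_{i,j}, and E_{l,l+1} as a second order operator
   [raiseX l]; since [E_{l,l+1}, x_{i+1,i} + D_i] = delta_{l,i} h_i is an identity
   of differential operators, it persists on series with complex exponents.  Its
   binomial expansion shows that eta_i^c, with c - 1 the h_i-weight of a solution f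
   of all equations [raiseX l f = 0], maps f to a solution and acts on the
   rho-shifted weight of f by the transposition (i, i+1).  So every theta is a
   solution, and the weights of the theta's are all the permutations of that of
   v_lambda.  A solution of given weight is determined by the coefficient of its
   only monomial in the variables x_{i+1,i}, which is 1 for theta.  Finally the
   eigenvalues of the Gelfand invariants tr(E^k) show that the rho-shifted weight
   of a singular vector is a permutation of that of v_lambda.  Hence singular lines
   correspond to the permutations of this weight that occur in M_lambda. *)

(* The module is known only through its basis, so the action of E_{l,l+1} on the E^alpha v is never
   computed. Only E_{i+1,i} is read off on these words; as the E_{i+1,i} generate M from v, the
   commutation relation then forces E_{l,l+1} to be [raiseX l]. The obstacle with eta is that it is
   an infinite sum with complex exponents. Applying [raiseX l] to its partial sums telescopes to one
   boundary term, in which the exponent of x_{i+1,i} drops as the sum gets longer; at a fixed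
   exponent this term is eventually 0. Weights are read in gl(n) with the identity acting by 0, so
   that the Weyl group permutes n numbers. The recursion for the eigenvalues of tr(E^k) on a highest
   weight vector shows that 1 - X sum_k tr(E^k) X^k is prod (1 - (x + 1) X) / prod (1 - x X), with x
   running over the shifted weight. The multiset of the x is recovered from this quotient because a
   difference of multiplicities that is periodic with period 1 and has finite support vanishes. *)
From HB Require Import structures.
Require Import Defs.
From mathcomp Require Import all_boot all_order all_algebra.
From mathcomp Require Import all_classical reals.
From mathcomp Require Import complex.
From mathcomp Require Import perm mpoly zify ring.
Set Implicit Arguments.
Unset Strict Implicit.
Unset Printing Implicit Defensive.
Import Order.TTheory GRing.Theory Num.Theory.
Local Open Scope classical_set_scope.
Local Open Scope ring_scope.

(** * Operators on formal series *)

(* The operations are locked: otherwise unification sees through the sum of two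
   functions and finds sums inside the operators below. *)
Section SeriesModule.
Context {C : fieldType}.
Implicit Types (f g h : series C) (a b : C).

Definition series_zero : series C := locked (fun=> 0).
Definition series_opp f : series C := locked (fun e => - f e).
Definition series_add f g : series C := locked (fun e => f e + g e).
Definition series_scale a f : series C := locked (fun e => a * f e).

Let zeroE e : series_zero e = 0. Proof. by rewrite /series_zero -lock. Qed.
Let oppE f e : series_opp f e = - f e. Proof. by rewrite /series_opp -lock. Qed.
Let addE f g e : series_add f g e = f e + g e.
Proof. by rewrite /series_add -lock. Qed.
Let scaleE a f e : series_scale a f e = a * f e.
Proof. by rewrite /series_scale -lock. Qed.
Let opE := (zeroE, oppE, addE, scaleE).

Let addA : associative series_add.
Proof. by move=> f g h; apply/funext => e; rewrite !opE addrA. Qed.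
Let addC : commutative series_add.
Proof. by move=> f g; apply/funext => e; rewrite !opE addrC. Qed.
Let add0 : left_id series_zero series_add.
Proof. by move=> f; apply/funext => e; rewrite !opE add0r. Qed.
Let addN : left_inverse series_zero series_opp series_add.
Proof. by move=> f; apply/funext => e; rewrite !opE addNr. Qed.

HB.instance Definition _ := gen_eqMixin (series C).
HB.instance Definition _ := gen_choiceMixin (series C).
HB.instance Definition _ :=
  GRing.isZmodule.Build (series C) addA addC add0 addN.

Lemma seriesD f g e : (f + g) e = f e + g e. Proof. exact: addE. Qed.

Let scaleA a b f :
  series_scale a (series_scale b f) = series_scale (a * b) f.
Proof. by apply/funext => e; rewrite !opE mulrA. Qed.
Let scale1 : left_id 1 series_scale.
Proof. by move=> f; apply/funext => e; rewrite !opE mul1r. Qed.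
Let scaleDr : right_distributive series_scale (@GRing.add (series C)).
Proof. by move=> a f g; apply/funext => e; rewrite !(seriesD, opE) mulrDr. Qed.
Let scaleDl f : {morph series_scale^~ f : a b / a + b}.
Proof. by move=> a b; apply/funext => e; rewrite !(seriesD, opE) mulrDl. Qed.

HB.instance Definition _ := GRing.Zmodule_isLmodule.Build C (series C)
  scaleA scale1 scaleDr scaleDl.

Lemma seriesN f e : (- f) e = - f e. Proof. exact: oppE. Qed.
Lemma seriesZ a f e : (a *: f) e = a * f e. Proof. exact: scaleE. Qed.
Lemma series0 e : (0 : series C) e = 0. Proof. exact: zeroE. Qed.

End SeriesModule.

Section Operators.
Context {C : fieldType}.
Implicit Types (f g : series C) (e : expo C).

Lemma series_sum (I : Type) (r : seq I) (P : pred I) (F : I -> series C) e :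
  (\sum_(i <- r | P i) F i) e = \sum_(i <- r | P i) F i e.
Proof.
elim/big_rec2: _ => [|i x y _ <-]; [exact: series0|exact: seriesD].
Qed.
Definition seriesE := (@seriesD C, @seriesN C, @seriesZ C, @series0 C, series_sum).

(** With phi affine in the exponents these are polynomials of degree at most one in the Euler
    operators x_{i,j} d/dx_{i,j}; moving them past x_{i,j}^c or a derivative only translates phi. *)
Definition diag (phi : expo C -> C) f : series C := fun e => phi e * f e.

Lemma mulXE i j c f e : mulX i j c f e = f (shift i j (- c) e). Proof. by []. Qed.
Lemma partialXE i j f e :
  partialX i j f e = (e i j + 1) * f (shift i j 1 e). Proof. by []. Qed.
Lemma diagE phi f e : diag phi f e = phi e * f e. Proof. by []. Qed.

Lemma mulX_linear i j c : linear (@mulX C i j c).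
Proof. by move=> a f g; apply/funext => e; rewrite !seriesE !mulXE !seriesE. Qed.
Lemma partialX_linear i j : linear (@partialX C i j).
Proof.
move=> a f g; apply/funext => e.
by rewrite !seriesE !partialXE !seriesE mulrDr mulrCA.
Qed.
Lemma diag_linear phi : linear (diag phi).
Proof.
move=> a f g; apply/funext => e.
by rewrite !seriesE !diagE !seriesE mulrDr mulrCA.
Qed.
HB.instance Definition _ i j c :=
  GRing.isLinear.Build C (series C) (series C) *:%R _ (mulX_linear i j c).
HB.instance Definition _ i j :=
  GRing.isLinear.Build C (series C) (series C) *:%R _ (partialX_linear i j).
HB.instance Definition _ phi :=
  GRing.isLinear.Build C (series C) (series C) *:%R _ (diag_linear phi).

Lemma shiftC i j (c : C) a b d e :
  shift i j c (shift a b d e) = shift a b d (shift i j c e).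
Proof.
apply/funext => x; apply/funext => y; rewrite /shift.
by case: (_ && _); case: (_ && _) => //; rewrite addrAC.
Qed.

Lemma shiftD i j (c d : C) e : shift i j c (shift i j d e) = shift i j (c + d) e.
Proof.
apply/funext => x; apply/funext => y; rewrite /shift.
by case: (_ && _) => //; rewrite addrAC addrA.
Qed.

Lemma shift0 i j e : shift i j (0 : C) e = e.
Proof.
by apply/funext => x; apply/funext => y; rewrite /shift addr0 if_same.
Qed.

Lemma shift_at i j (c : C) e : shift i j c e i j = e i j + c.
Proof. by rewrite /shift !eqxx. Qed.

Lemma shift_neq i j (c : C) e a b : (a, b) != (i, j) -> shift i j c e a b = e a b.
Proof. by rewrite /shift -xpair_eqE => /negbTE ->. Qed.

Lemma mulXC i j a b c d f : mulX i j c (mulX a b d f) = mulX a b d (mulX i j c f).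
Proof. by apply/funext => e; rewrite /mulX shiftC. Qed.

Lemma mulXD i j c d f : mulX i j c (mulX i j d f) = mulX i j (c + d) f.
Proof. by apply/funext => e; rewrite /mulX shiftD opprD addrC. Qed.

Lemma mulX0 i j f : mulX i j 0 f = f.
Proof. by apply/funext => e; rewrite /mulX oppr0 shift0. Qed.

Lemma partialXC i j a b f :
  partialX i j (partialX a b f) = partialX a b (partialX i j f).
Proof.
apply/funext => e; rewrite /partialX.
have [[-> ->]//|ne] := eqVneq (a, b) (i, j).
rewrite (shift_neq _ _ ne) shift_neq; last by rewrite eq_sym.
by rewrite mulrCA shiftC.
Qed.

Lemma partial_mulX_neq i j a b c f : (a, b) != (i, j) ->
  partialX a b (mulX i j c f) = mulX i j c (partialX a b f).
Proof.
by move=> ne; apply/funext => e; rewrite /partialX /mulX shiftC shift_neq.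
Qed.

Lemma partial_mulX i j c f :
  partialX i j (mulX i j c f) =
  mulX i j c (partialX i j f) + c *: mulX i j (c - 1) f.
Proof.
apply/funext => e; rewrite !seriesE /partialX /mulX !shiftD shift_at.
by rewrite opprB [1 - c]addrC; ring.
Qed.

Lemma mul_partial i j c f :
  mulX i j c (partialX i j f) = mulX i j (c - 1) (diag (fun e => e i j) f).
Proof.
apply/funext => e; rewrite /partialX /mulX /diag !shiftD !shift_at.
by rewrite opprB -addrA [- c + 1]addrC.
Qed.

Lemma diag_mulX phi psi i j c f :
  (forall e, phi (shift i j c e) = psi e) ->
  diag phi (mulX i j c f) = mulX i j c (diag psi f).
Proof.
move=> H; apply/funext => e; rewrite /diag /mulX -H.
by rewrite shiftD subrr shift0.
Qed.

Lemma diag_partial phi psi i j f :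
  (forall e, phi (shift i j (-1) e) = psi e) ->
  diag phi (partialX i j f) = partialX i j (diag psi f).
Proof.
move=> H; apply/funext => e; rewrite /diag /partialX -H.
by rewrite shiftD addNr shift0 mulrCA.
Qed.

Definition vecX (q r : nat * nat) f : series C :=
  mulX q.1 q.2 1 (partialX r.1 r.2 f).

Lemma vecXE q r f : vecX q r f = mulX q.1 q.2 1 (partialX r.1 r.2 f). Proof. by []. Qed.

Lemma vecX_linear q r : linear (vecX q r).
Proof. by move=> a f g; rewrite /vecX !linearP. Qed.
HB.instance Definition _ q r :=
  GRing.isLinear.Build C (series C) (series C) *:%R _ (vecX_linear q r).

Lemma vecX_diag q f : vecX q q f = diag (fun e => e q.1 q.2) f.
Proof. by rewrite /vecX mul_partial subrr mulX0. Qed.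

(** The relations of matrix units: the x_q d/dx_r span a gl indexed by all pairs of naturals, in
    which [row_Dop] and [col_Dop] are computed. *)
Lemma vecX_comm q r s t f :
  vecX q r (vecX s t f) - vecX s t (vecX q r f) =
  (r == s)%:R *: vecX q t f - (t == q)%:R *: vecX s r f.
Proof.
have step (a b : nat * nat) (h : series C) :
    partialX a.1 a.2 (mulX b.1 b.2 1 h) =
    mulX b.1 b.2 1 (partialX a.1 a.2 h) + (a == b)%:R *: h.
  have [->|ne] := eqVneq a b.
    by rewrite partial_mulX subrr mulX0.
  by rewrite partial_mulX_neq ?scale0r ?addr0.
rewrite /vecX !step // (linearD (mulX q.1 q.2 1)) (linearD (mulX s.1 s.2 1)).
rewrite !linearZ /= mulXC [partialX r.1 _ _]partialXC.
by rewrite scalerN opprD addrACA subrr add0r.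
Qed.

Lemma vecX_comm_sum (r1 r2 : seq nat) (q r s t : nat -> nat * nat) f :
  \sum_(b <- r1) vecX (q b) (r b) (\sum_(j <- r2) vecX (s j) (t j) f)
  - \sum_(j <- r2) vecX (s j) (t j) (\sum_(b <- r1) vecX (q b) (r b) f) =
  \sum_(b <- r1) \sum_(j <- r2)
    ((r b == s j)%:R *: vecX (q b) (t j) f
     - (t j == q b)%:R *: vecX (s j) (r b) f).
Proof.
under eq_bigr do rewrite linear_sum.
under [X in _ - X]eq_bigr do rewrite linear_sum.
rewrite [X in _ - X]exchange_big -sumrB; apply: eq_bigr => b _.
by rewrite -sumrB; apply: eq_bigr => j _; rewrite vecX_comm.
Qed.

Lemma sum_delta (V : lmodType C) m k c (F : nat -> V) :
  \sum_(m <= j < k) (j == c)%:R *: F j = (m <= c < k)%N%:R *: F c.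
Proof.
have [cin|cout] := boolP (m <= c < k)%N.
  rewrite (bigD1_seq c) ?mem_index_iota ?iota_uniq //= eqxx big1 ?addr0 //.
  by move=> j /negbTE ->; rewrite scale0r.
rewrite scale0r big_nat big1 // => j jin; case: eqP => [jc|]; last by rewrite scale0r.
by rewrite -jc jin in cout.
Qed.

Lemma DopE i f : Dop i f = \sum_(1 <= j < i) vecX (i.+1, j) (i, j) f.
Proof. by apply/funext => e; rewrite series_sum. Qed.

Lemma Dop_linear i : linear (@Dop C i).
Proof.
move=> a f g; rewrite !DopE scaler_sumr -big_split /=.
by apply: eq_bigr => j _; rewrite linearP.
Qed.
HB.instance Definition _ i :=
  GRing.isLinear.Build C (series C) (series C) *:%R _ (Dop_linear i).

(** For l = i the two sums are the e and f of an sl(2) exchanging rows i and i + 1, with h the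
    difference of the row degrees; for l != i no positions match. *)
Lemma row_Dop l i f :
  \sum_(1 <= b < l) vecX (l, b) (l.+1, b) (Dop i f)
  - Dop i (\sum_(1 <= b < l) vecX (l, b) (l.+1, b) f) =
  (l == i)%:R *: diag (fun e => \sum_(1 <= b < i) (e i b - e i.+1 b)) f.
Proof.
rewrite !DopE (vecX_comm_sum _ _ (pair l) (pair l.+1) (pair i.+1) (pair i)).
have [<-|ne] := eqVneq l i; last first.
  rewrite scale0r big1 // => b _; rewrite big1 // => j _.
  by rewrite !xpair_eqE eqSS [i == l]eq_sym (negbTE ne) !scale0r subr0.
have -> : true%:R *: diag (fun e => \sum_(1 <= b < l) (e l b - e l.+1 b)) f =
    \sum_(1 <= b < l) (vecX (l, b) (l, b) f - vecX (l.+1, b) (l.+1, b) f).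
  rewrite scale1r; apply/funext => e; rewrite series_sum diagE mulr_suml.
  by apply: eq_bigr => b _; rewrite !seriesE !vecX_diag !diagE mulrBl.
rewrite big_nat [RHS]big_nat; apply: eq_bigr => b bin.
rewrite sumrB; congr (_ - _).
  under eq_bigr do rewrite xpair_eqE eqxx eq_sym.
  by rewrite (sum_delta _ _ b (fun j => vecX (l, b) (l, j) f)) bin scale1r.
under eq_bigr do rewrite xpair_eqE eqxx.
by rewrite (sum_delta _ _ b (fun j => vecX (l.+1, j) (l.+1, b) f)) bin scale1r.
Qed.

(** The two kinds of matches, a = i + 1 with j = l and a = i with j = l + 1, give opposite terms;
    the bound j < i separates them only when l + 1 = i. *)
Lemma col_Dop n l i f : (0 < l)%N -> (i < n)%N ->
  \sum_(l.+2 <= a < n.+1) vecX (a, l.+1) (a, l) (Dop i f)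
  - Dop i (\sum_(l.+2 <= a < n.+1) vecX (a, l.+1) (a, l) f) =
  (l.+1 == i)%:R *: vecX (i.+1, i) (i, l) f.
Proof.
move=> l0 iN.
rewrite !DopE (vecX_comm_sum _ _ (pair^~ l.+1) (pair^~ l) (pair i.+1) (pair i)).
under eq_bigr do rewrite sumrB.
rewrite sumrB.
have -> : \sum_(l.+2 <= a < n.+1) \sum_(1 <= j < i)
     ((a, l) == (i.+1, j))%:R *: vecX (a, l.+1) (i, j) f =
     (l < i)%:R *: vecX (i.+1, l.+1) (i, l) f.
  transitivity (\sum_(l.+2 <= a < n.+1) (a == i.+1)%:R *:
      ((0 < l < i)%N%:R *: vecX (a, l.+1) (i, l) f)).
    apply: eq_bigr => a _.
    rewrite -(sum_delta _ _ _ (fun j => vecX (a, l.+1) (i, j) f)).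
    rewrite scaler_sumr; apply: eq_bigr => j _.
    by rewrite xpair_eqE scalerA -natrM mulnb [l == j]eq_sym.
  rewrite (sum_delta _ _ _ (fun a => _ *: vecX (a, l.+1) (i, l) f)).
  rewrite scalerA -natrM mulnb; congr (_%:R *: _); lia.
have -> : \sum_(l.+2 <= a < n.+1) \sum_(1 <= j < i)
     ((i, j) == (a, l.+1))%:R *: vecX (i.+1, j) (a, l) f =
     (l.+1 < i)%:R *: vecX (i.+1, l.+1) (i, l) f.
  transitivity (\sum_(l.+2 <= a < n.+1) (a == i)%:R *:
      ((0 < l.+1 < i)%N%:R *: vecX (i.+1, l.+1) (a, l) f)).
    apply: eq_bigr => a _.
    rewrite -(sum_delta _ _ _ (fun j => vecX (i.+1, j) (a, l) f)).
    rewrite scaler_sumr; apply: eq_bigr => j _.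
    by rewrite xpair_eqE scalerA -natrM mulnb [i == a]eq_sym.
  rewrite (sum_delta _ _ _ (fun a => _ *: vecX (i.+1, l.+1) (a, l) f)).
  rewrite scalerA -natrM mulnb; congr (_%:R *: _); lia.
rewrite -scalerBl; have [<-|ne] := eqVneq l.+1 i.
  by rewrite ltnn ltnSn subr0.
by rewrite [(l.+1 < i)%N]ltn_neqAle ne subrr !scale0r.
Qed.

End Operators.

(** * The raising operators *)

Section Raising.
Context {C : numFieldType} (n : nat) (Lam : nat -> C).
Implicit Types (f g : series C) (e : expo C).

(* The weight of x^e under E_{k,k} *)
Definition glwt (k : nat) e : C :=
  Lam k + \sum_(1 <= b < k) e k b - \sum_(k.+1 <= a < n.+1) e a k.

(** Moving E_{l,l+1} past E_{l+1,l}^k on a vector of h_l-weight h yields k (h - k + 1). The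
    derivative supplies k and leaves the exponent k - 1, so this is the second factor; h comes from
    lambda and from the factors E_{a,b} with a > l + 1. *)
Definition raise_coef (l : nat) e : C :=
  Lam l - Lam l.+1 - \sum_(l.+1 <= a < n.+1) e a l
  + \sum_(l.+2 <= a < n.+1) e a l.+1.

(* The operator by which E_{l,l+1} acts on the Verma module *)
Definition raiseX (l : nat) f : series C :=
  diag (raise_coef l) (partialX l.+1 l f)
  + \sum_(1 <= b < l) vecX (l, b) (l.+1, b) f
  - \sum_(l.+2 <= a < n.+1) vecX (a, l.+1) (a, l) f.

Lemma raiseX_linear l : linear (raiseX l).
Proof.
move=> a f g; rewrite /raiseX !linearP /=.
under eq_bigr do rewrite linearP /=.
under [X in _ - X]eq_bigr do rewrite linearP /=.
rewrite !big_split /= -!scaler_sumr !scalerDr scalerN.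
by rewrite addrACA opprD [LHS]addrACA.
Qed.
HB.instance Definition _ l :=
  GRing.isLinear.Build C (series C) (series C) *:%R _ (raiseX_linear l).

Lemma glwt_root l e : (0 < l < n)%N ->
  glwt l e - glwt l.+1 e =
  raise_coef l e - e l.+1 l + \sum_(1 <= b < l) (e l b - e l.+1 b).
Proof.
move=> ln; rewrite /glwt /raise_coef sumrB.
rewrite (big_nat_recr l 1 (fun b => e l.+1 b)) /=; last by lia.
by ring.
Qed.

Lemma sum_shift_col m k x y (c : C) e j :
  \sum_(m <= a < k) shift x y c e a j =
  \sum_(m <= a < k) e a j + ((m <= x < k)%N && (j == y))%:R * c.
Proof.
have [->|ne] := eqVneq j y; last first.
  rewrite andbF mul0r addr0; apply: eq_bigr => a _.
  by rewrite shift_neq // xpair_eqE negb_and ne orbT.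
rewrite andbT -[_ * c]/(_ *: (c : C^o)) -(sum_delta m k x (fun=> c : C^o)).
rewrite -big_split; apply: eq_bigr => a _ /=.
by rewrite /shift eqxx andbT; case: eqP; rewrite ?scale1r ?scale0r ?addr0.
Qed.

Lemma raise_coef_mulX l i c e : (0 < i < n)%N ->
  raise_coef l (shift i.+1 i c e) =
  raise_coef l e + ((l.+1 == i)%:R - (l == i)%:R) * c.
Proof.
move=> ip; rewrite /raise_coef !sum_shift_col.
have -> : ((l.+1 <= i.+1 < n.+1)%N && (l == i)) = (l == i) by lia.
have -> : ((l.+2 <= i.+1 < n.+1)%N && (l.+1 == i)) = (l.+1 == i) by lia.
by ring.
Qed.

Lemma raise_coef_Dop l i f : (i < n)%N ->
  diag (raise_coef l) (Dop i f) = Dop i (diag (raise_coef l) f).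
Proof.
move=> iN; rewrite !DopE raddf_sum big_nat [RHS]big_nat; apply: eq_bigr => j jin /=.
rewrite !vecXE (diag_mulX (psi := fun e => raise_coef l e
   + ((l.+1 == j)%:R * (l.+2 <= i.+1)%N%:R - (l == j)%:R * (l.+1 <= i.+1)%N%:R))).
  rewrite (diag_partial (psi := raise_coef l)) // => e.
  rewrite /raise_coef !sum_shift_col /=.
  have -> : ((l.+1 <= i < n.+1)%N && (l == j)) = (l == j) && (l < i.+1)%N by lia.
  have -> : ((l.+2 <= i < n.+1)%N && (l.+1 == j)) =
      (l.+1 == j) && (l.+1 < i.+1)%N by lia.
  by rewrite -!mulnb !natrM; ring.
move=> e; rewrite /raise_coef !sum_shift_col /=.
have -> : ((l.+1 <= i.+1 < n.+1)%N && (l == j)) = (l == j) && (l < i.+1)%N by lia.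
have -> : ((l.+2 <= i.+1 < n.+1)%N && (l.+1 == j)) =
    (l.+1 == j) && (l.+1 < i.+1)%N by lia.
by rewrite -!mulnb !natrM; ring.
Qed.

Lemma vecX_mulX q r i j c f : r != (i, j) ->
  vecX q r (mulX i j c f) = mulX i j c (vecX q r f).
Proof.
case: r => a b ne; rewrite !vecXE (partial_mulX_neq _ _ ne); exact: mulXC.
Qed.

Lemma vec_sums_mulX l i c f :
  \sum_(1 <= b < l) vecX (l, b) (l.+1, b) (mulX i.+1 i c f)
  - \sum_(l.+2 <= a < n.+1) vecX (a, l.+1) (a, l) (mulX i.+1 i c f) =
  mulX i.+1 i c (\sum_(1 <= b < l) vecX (l, b) (l.+1, b) f
  - \sum_(l.+2 <= a < n.+1) vecX (a, l.+1) (a, l) f).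
Proof.
rewrite raddfB !raddf_sum /=; congr (_ + _); rewrite big_nat [RHS]big_nat;
  apply: eq_bigr => b bin; rewrite vecX_mulX //= xpair_eqE; lia.
Qed.

Lemma raiseX_mulX_neq l i c f : (0 < i < n)%N -> l != i ->
  raiseX l (mulX i.+1 i c f) =
  mulX i.+1 i c (raiseX l f)
  + (c * (l.+1 == i)%:R) *: mulX i.+1 i c (partialX i l f).
Proof.
move=> ip ne; rewrite /raiseX -!addrA vec_sums_mulX.
rewrite [mulX i.+1 i c (_ + (_ - _))]raddfD /= [RHS]addrAC; congr (_ + _).
rewrite partial_mulX_neq; last by rewrite xpair_eqE eqSS (negbTE ne).
rewrite (diag_mulX (psi := fun e => raise_coef l e + (l.+1 == i)%:R * c)); last first.
  by move=> e; rewrite raise_coef_mulX // (negbTE ne) subr0.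
apply/funext => e; rewrite !seriesE ?mulXE ?diagE mulrDl; congr (_ + _).
by have [->|] := eqVneq l.+1 i; rewrite ?mulr1 ?mul1r // mulr0 !mul0r.
Qed.

Lemma raiseX_mulX i c f : (0 < i < n)%N ->
  raiseX i (mulX i.+1 i c f) =
  mulX i.+1 i c (raiseX i f)
  + c *: mulX i.+1 i (c - 1) (diag (fun e => raise_coef i e - e i.+1 i - c + 1) f).
Proof.
move=> ip; rewrite /raiseX -!addrA vec_sums_mulX.
rewrite [mulX i.+1 i c (_ + (_ - _))]raddfD /= [RHS]addrAC; congr (_ + _).
rewrite partial_mulX raddfD /= linearZ /=.
rewrite (diag_mulX (psi := fun e => raise_coef i e - c)); last first.
  by move=> e; rewrite raise_coef_mulX // eqxx gtn_eqF //=; ring.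
rewrite (diag_mulX (psi := fun e => raise_coef i e - (c - 1))); last first.
  by move=> e; rewrite raise_coef_mulX // eqxx gtn_eqF //=; ring.
have -> : diag (fun e => raise_coef i e - c) (partialX i.+1 i f) =
   diag (raise_coef i) (partialX i.+1 i f) - c *: partialX i.+1 i f.
  by apply/funext => e; rewrite !seriesE !diagE mulrBl.
rewrite raddfB /= -addrA; congr (_ + _).
rewrite [mulX _ _ _ (c *: _)]linearZ /= mul_partial addrC -scalerBr -raddfB /=.
congr (_ *: mulX _ _ _ _).
by apply/funext => e; rewrite !seriesE !diagE; ring.
Qed.

(** The last term is opposite to the extra one of [raiseX_mulX_neq] for c = 1, which is why
    E_{l,l+1} commutes with x_{i+1,i} + D_i when l + 1 = i. *)
Lemma raiseX_Dop l i f : (0 < l)%N -> (i < n)%N ->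
  raiseX l (Dop i f) = Dop i (raiseX l f)
  + (l == i)%:R *: diag (fun e => \sum_(1 <= b < i) (e i b - e i.+1 b)) f
  - (l.+1 == i)%:R *: vecX (i.+1, i) (i, l) f.
Proof.
move=> l0 iN; rewrite -row_Dop -(col_Dop (n := n)) //.
rewrite /raiseX [in RHS]raddfB [in RHS]raddfD /=.
have -> : partialX l.+1 l (Dop i f) = Dop i (partialX l.+1 l f).
  rewrite !DopE raddf_sum big_nat [RHS]big_nat; apply: eq_bigr => j jin /=.
  by rewrite !vecXE /= partial_mulX_neq 1?partialXC // xpair_eqE; lia.
rewrite raise_coef_Dop //.
by apply/funext => e; rewrite !(seriesD, seriesN); ring.
Qed.

End Raising.

(** * The operators eta *)

Section Eta.
Context {C : numFieldType} (n : nat) (Lam : nat -> C).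
Implicit Types (f g : series C) (e : expo C).
Local Notation raiseX := (raiseX n Lam).
Local Notation glwt := (glwt n Lam).

Lemma Dop_mulX i c f : Dop i (mulX i.+1 i c f) = mulX i.+1 i c (Dop i f).
Proof.
rewrite !DopE raddf_sum big_nat [RHS]big_nat; apply: eq_bigr => j jin /=.
by rewrite vecX_mulX // xpair_eqE; lia.
Qed.

Lemma Dop_partial i l f : Dop i (partialX i l f) = partialX i l (Dop i f).
Proof.
rewrite !DopE raddf_sum big_nat [RHS]big_nat; apply: eq_bigr => j jin /=.
by rewrite !vecXE /= partialXC partial_mulX_neq // xpair_eqE; lia.
Qed.

Lemma iterDop_linear i p : linear (iter p (@Dop C i)).
Proof. by elim: p => // p IH a f g; rewrite !iterS IH linearP. Qed.
HB.instance Definition _ i p :=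
  GRing.isLinear.Build C (series C) (series C) *:%R _ (iterDop_linear i p).

Lemma iterDop_comm i p (T : series C -> series C) f :
  (forall g, Dop i (T g) = T (Dop i g)) ->
  iter p (Dop i) (T f) = T (iter p (Dop i) f).
Proof. by move=> TD; elim: p => // p IH; rewrite !iterS IH TD. Qed.

Lemma raiseX_iterDop_neq l i p f : (0 < l)%N -> (i < n)%N -> l != i ->
  raiseX l (iter p (Dop i) f) = iter p (Dop i) (raiseX l f)
  - (p%:R * (l.+1 == i)%:R) *:
    mulX i.+1 i 1 (iter p.-1 (Dop i) (partialX i l f)).
Proof.
move=> l0 iN ne; elim: p => [|p IH].
  by rewrite mul0r scale0r subr0.
rewrite iterS raiseX_Dop // (negbTE ne) scale0r addr0 IH vecXE /=.
rewrite linearB /= [Dop i (_ *: _)]linearZ /= Dop_mulX.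
rewrite -(iterDop_comm p f (fun g => Dop_partial i l g)) -addrA -opprD.
have [->|] := eqVneq p 0%N; first by rewrite mul0r scale0r add0r mul1r.
by move=> p0; rewrite -iterS prednK ?lt0n // -scalerDl -natr1 mulrDl mul1r.
Qed.

Lemma diag_row_Dop i f c :
  diag (fun e => \sum_(1 <= b < i) (e i b - e i.+1 b) + c) (Dop i f) =
  Dop i (diag (fun e => \sum_(1 <= b < i) (e i b - e i.+1 b) + (c - 2)) f).
Proof.
have sumS j x a y e : (0 < j < i)%N ->
    \sum_(1 <= b < i) shift x j y e a b =
    \sum_(1 <= b < i) e a b + (a == x)%:R * y.
  move=> jin; rewrite -[_ * y]/(_ *: (y : C^o)).
  have -> : (a == x)%:R *: (y : C^o) =
      \sum_(1 <= b < i) (b == j)%:R *: ((a == x)%:R * y : C^o).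
    by rewrite (sum_delta 1 i j (fun=> _ : C^o)) jin scale1r.
  rewrite -big_split; apply: eq_bigr => b _ /=; rewrite /shift.
  by case: (a == x); case: (b == j); rewrite /= ?scale1r ?scale0r ?mul1r ?mul0r ?addr0.
rewrite !DopE raddf_sum big_nat [RHS]big_nat; apply: eq_bigr => j jin /=.
rewrite !vecXE (diag_mulX (psi := fun e =>
  \sum_(1 <= b < i) (e i b - e i.+1 b) + (c - 1))); last first.
  by move=> e; rewrite !sumrB !sumS // eqxx ltn_eqF //=; ring.
rewrite (diag_partial (psi := fun e =>
  \sum_(1 <= b < i) (e i b - e i.+1 b) + (c - 2))) // => e.
by rewrite !sumrB !sumS // eqxx gtn_eqF //=; ring.
Qed.

(** The sl(2) formula e f^p = p f^(p-1) (h - (p - 1)) on a vector killed by e, with h the row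
    difference of [row_Dop]. *)
Lemma raiseX_iterDop i p f : (0 < i < n)%N -> raiseX i f = 0 ->
  raiseX i (iter p (Dop i) f) = p%:R *: iter p.-1 (Dop i)
    (diag (fun e => \sum_(1 <= b < i) (e i b - e i.+1 b) - (p%:R - 1)) f).
Proof.
move=> /andP[i0 iN] f0.
have DL q c : diag (fun e => \sum_(1 <= b < i) (e i b - e i.+1 b) + c)
      (iter q (Dop i) f) =
    iter q (Dop i) (diag (fun e => \sum_(1 <= b < i) (e i b - e i.+1 b)
      + (c - 2 * q%:R)) f).
  elim: q c => [|q IH] c; first by rewrite mulr0 subr0.
  rewrite iterS diag_row_Dop IH -iterS; congr iter.
  by apply/funext => e; rewrite !diagE -natr1; ring.
elim: p => [|p IH]; first by rewrite scale0r.
rewrite iterS raiseX_Dop // eqxx (gtn_eqF (ltnSn i)) scale0r subr0 scale1r.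
rewrite IH linearZ /=.
have -> : p%:R *: Dop i (iter p.-1 (Dop i) (diag (fun e =>
     \sum_(1 <= b < i) (e i b - e i.+1 b) - (p%:R - 1)) f)) =
   p%:R *: iter p (Dop i) (diag (fun e =>
     \sum_(1 <= b < i) (e i b - e i.+1 b) - (p%:R - 1)) f).
  by case: p {IH} => [|p]; rewrite ?scale0r //= iterS.
have -> g : diag (fun e => \sum_(1 <= b < i) (e i b - e i.+1 b)) g =
    diag (fun e => \sum_(1 <= b < i) (e i b - e i.+1 b) + 0) g.
  by apply/funext => e; rewrite !diagE addr0.
rewrite DL -!linearZ -linearD /=; congr iter.
by apply/funext => e; rewrite !(seriesD, seriesZ, diagE) -natr1; ring.
Qed.

(** Operators cannot be exchanged directly with the coefficientwise infinite sum; each coefficient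
    of eta is that of a partial sum, and the equations are checked there. *)
Definition eta_trunc i mu N f : series C :=
  \sum_(p < N) eta_term i mu f p.

Lemma eta_termE i mu f p : eta_term i mu f p =
  (falling mu p / p`!%:R) *: mulX i.+1 i (mu - p%:R) (iter p (Dop i) f).
Proof. by apply/funext => e; rewrite seriesZ. Qed.

Lemma eta_coefS (mu : C) N :
  falling mu N.+1 / N.+1`!%:R * N.+1%:R = falling mu N / N`!%:R * (mu - N%:R).
Proof.
rewrite /falling big_ord_recr /= factS natrM invfM.
have N0 : N.+1%:R != 0 :> C by rewrite pnatr_eq0.
have F0 : N`!%:R != 0 :> C by rewrite pnatr_eq0 -lt0n fact_gt0.
move: N0 F0; move: (N.+1%:R : C) (N`!%:R : C) => a b a0 b0.
by field; rewrite a0 b0.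
Qed.

(** The sum telescopes: by [eta_coefS] the contribution of x_{i+1,i}^(mu-N) in the term N cancels
    that of D_i^(N+1) in the next one, and only the last is left. *)
Lemma raiseX_trunc_neq l i mu N f : (0 < l)%N -> (0 < i < n)%N -> l != i ->
  raiseX l f = 0 ->
  raiseX l (eta_trunc i mu N f) =
  (falling mu N / N`!%:R * N%:R * (l.+1 == i)%:R) *:
    mulX i.+1 i (mu - N%:R + 1) (iter N.-1 (Dop i) (partialX i l f)).
Proof.
move=> l0 ip ne f0; rewrite /eta_trunc; elim: N => [|N IH].
  by rewrite big_ord0 raddf0 mulr0 mul0r scale0r.
have iN : (i < n)%N by case/andP: ip.
rewrite big_ord_recr raddfD /= IH eta_termE [raiseX l (_ *: _)]linearZ /=.
rewrite raiseX_mulX_neq // raiseX_iterDop_neq // f0 raddf0 sub0r.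
rewrite -(iterDop_comm N f (fun g => Dop_partial i l g)) eta_coefS.
rewrite raddfN /= [mulX _ _ _ (_ *: _)]linearZ /= mulXD -natr1 opprD addrA subrK.
by apply/funext => e; rewrite !(seriesD, seriesZ, seriesN); ring.
Qed.

(** The same telescoping for l = i, where the contributions of consecutive terms match because the
    h_i-weight of f is mu - 1. *)
Lemma raiseX_trunc i mu N f : (0 < i < n)%N -> raiseX i f = 0 ->
  (forall e, f e != 0 -> glwt i e - glwt i.+1 e = mu - 1) ->
  raiseX i (eta_trunc i mu N f) =
  - (falling mu N / N`!%:R * N%:R) *:
    mulX i.+1 i (mu - N%:R) (iter N.-1 (Dop i)
    (diag (fun e => \sum_(1 <= b < i) (e i b - e i.+1 b) - (N%:R - 1)) f)).
Proof.
move=> ip f0 fw; rewrite /eta_trunc; elim: N => [|N IH].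
  by rewrite big_ord0 raddf0 mulr0 oppr0 scale0r.
have iN : (i < n)%N by case/andP: ip.
rewrite big_ord_recr raddfD /= IH eta_termE [raiseX i (_ *: _)]linearZ /=.
rewrite raiseX_mulX // raiseX_iterDop // [mulX _ _ _ (_ *: _)]linearZ /=.
(* The weight hypothesis turns [raise_coef n Lam i e - e i.+1 i] into mu - 1 minus the row
   difference, so the coefficient becomes N minus the row difference, as in [raiseX_iterDop] for N +
   1. *)
have -> : diag (fun e => raise_coef n Lam i e - e i.+1 i - (mu - N%:R) + 1)
      (iter N (Dop i) f) =
    - iter N (Dop i)
       (diag (fun e => \sum_(1 <= b < i) (e i b - e i.+1 b) - N%:R) f).
  have comm c g : Dop i (diag (fun e => raise_coef n Lam i e - e i.+1 i + c) g) =
      diag (fun e => raise_coef n Lam i e - e i.+1 i + c) (Dop i g).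
    have split h : diag (fun e => raise_coef n Lam i e - e i.+1 i + c) h =
        diag (raise_coef n Lam i) h - mulX i.+1 i 1 (partialX i.+1 i h) + c *: h.
      apply/funext => e; rewrite mul_partial subrr mulX0.
      by rewrite !(seriesD, seriesN, seriesZ, diagE); ring.
    rewrite !split linearD linearB linearZ /= raise_coef_Dop // Dop_mulX.
    congr (_ - mulX _ _ _ _ + _); rewrite !DopE raddf_sum big_nat [RHS]big_nat.
    apply: eq_bigr => j jin /=.
    by rewrite !vecXE /= partialXC partial_mulX_neq // xpair_eqE; lia.
  have -> : (fun e => raise_coef n Lam i e - e i.+1 i - (mu - N%:R) + 1) =
      (fun e => raise_coef n Lam i e - e i.+1 i + (1 - (mu - N%:R))).
    by apply/funext => e; ring.
  rewrite -(iterDop_comm N f (comm _)) -raddfN /=; congr iter.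
  apply/funext => e; rewrite seriesN !diagE.
  have [->|/fw] := eqVneq (f e) 0; first by rewrite !mulr0 oppr0.
  rewrite glwt_root // => /eqP; rewrite -subr_eq => /eqP E.
  rewrite -mulNr; congr (_ * _).
  by rewrite -E; ring.
rewrite [mulX _ _ _ (- _)]raddfN /= eta_coefS.
have -> : (N.+1%:R - 1 : C) = N%:R by rewrite -natr1 addrK.
have -> : (mu - N.+1%:R : C) = mu - N%:R - 1 by rewrite -natr1 opprD addrA.
by apply/funext => e; rewrite !(seriesD, seriesZ, seriesN); ring.
Qed.

Lemma A1_iterDop p (mu : 'I_p -> nat -> C) i f r : (0 < i < n)%N ->
  A1_exponents n mu f -> A1_exponents n mu (iter r (Dop i) f).
Proof. by move=> ip H; elim: r => //= r IH; exact: A1_D. Qed.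

(** The exponents of x_{i+1,i} lie in finitely many families mu - d, and D_i does not change them,
    so a low enough power of x_{i+1,i} misses any given exponent x. The bound depends on mu, c and x
    alone and serves all f of this shape and all r. *)
Lemma mulX_iterDop_eq0 p (mu : 'I_p -> nat -> C) i c x : (0 < i < n)%N ->
  exists N0, forall f N r e, A1_exponents n mu f -> (N0 <= N)%N -> e i.+1 i = x ->
    mulX i.+1 i (c - N%:R) (iter r (Dop i) f) e = 0.
Proof.
move=> ip; have [B HB] := nat_bound (fun q => mu q i + c - x).
exists B.+1 => f N r e H BN ex; apply: contrapT => /eqP; rewrite mulXE.
move/(A1_iterDop ip H) => [_ _ [q /(_ i ip)[d]]].
rewrite shift_at ex opprB => xE; suff: (N + d <= B)%N by lia.
apply: (HB q); rewrite natrD -[mu q i](subrK d%:R) -xE; ring.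
Qed.

Lemma eta_trunc_eq p (mu : 'I_p -> nat -> C) i c f x : (0 < i < n)%N ->
  A1_exponents n mu f ->
  exists N0, forall N e, (N0 <= N)%N -> e i.+1 i = x ->
    eta i c f e = eta_trunc i c N f e.
Proof.
move=> ip H; have [N0 H0] := eta_term_bound c x ip H.
exists N0 => N e NN ex; rewrite /eta /eta_trunc series_sum.
rewrite (fsbig_ord _ N (fun p => eta_term i c f p e)); apply/esym.
apply: fsbig_widen => // r [_ /= rN]; apply: contrapT => /eqP.
by move/(H0 e r ex) => rN0; apply: rN; rewrite (leq_trans rN0).
Qed.

Lemma vecX_local x y q r f g e : (q != r) ->
  (forall e', [\/ e' x y = e x y - 1, e' x y = e x y | e' x y = e x y + 1] ->
    f e' = g e') ->
  vecX q r f e = vecX q r g e.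
Proof.
move=> qr H; rewrite !vecXE !mulXE !partialXE; congr (_ * _); apply: H.
have [E|ne] := eqVneq (x, y) q.
  rewrite shift_neq ?E -?surjective_pairing //; constructor 1.
  by rewrite -E /= shift_at.
have [E|ne'] := eqVneq (x, y) r.
  by constructor 3; rewrite -E /= shift_at shift_neq // -surjective_pairing.
by constructor 2; rewrite !shift_neq // -surjective_pairing.
Qed.

(** Each term of [raiseX l] moves a single exponent by at most 1. A truncation that is exact at
    three values of the exponent of x_{i+1,i} can therefore replace eta. *)
Lemma raiseX_local x y l f g e :
  (forall e', [\/ e' x y = e x y - 1, e' x y = e x y | e' x y = e x y + 1] ->
    f e' = g e') ->
  raiseX l f e = raiseX l g e.
Proof.
move=> H; rewrite /raiseX !(seriesD, seriesN, series_sum); congr (_ + _ - _).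
- rewrite !diagE !partialXE; congr (_ * (_ * _)); apply: H.
  have [[-> ->]|ne] := eqVneq (x, y) (l.+1, l).
    by constructor 3; rewrite shift_at.
  by constructor 2; rewrite shift_neq.
- apply: eq_bigr => b _; apply: vecX_local H.
  by rewrite xpair_eqE ltn_eqF.
- apply: eq_bigr => a _; apply: vecX_local H.
  by rewrite xpair_eqE [l.+1 == l]gtn_eqF ?andbF.
Qed.

Lemma raiseX_eta l i mu f : (0 < l)%N -> (0 < i < n)%N -> in_A1 n f ->
  raiseX l f = 0 -> raiseX i f = 0 ->
  (forall e, f e != 0 -> glwt i e - glwt i.+1 e = mu - 1) ->
  raiseX l (eta i mu f) = 0.
Proof.
move=> l0 ip [[p [m [_ H]]] _] fl fi fw; apply/funext => e; rewrite series0.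
set x := e i.+1 i.
have [N1 H1] := eta_trunc_eq mu (x - 1) ip H.
have [N2 H2] := eta_trunc_eq mu x ip H.
have [N3 H3] := eta_trunc_eq mu (x + 1) ip H.
have trunc N : (N1 + N2 + N3 <= N)%N ->
    raiseX l (eta i mu f) e = raiseX l (eta_trunc i mu N f) e.
  move=> NN; apply: (raiseX_local (x := i.+1) (y := i)) => e' [] ex'.
  - by apply: H1 => //; lia.
  - by apply: H2 => //; lia.
  - by apply: H3 => //; lia.
have [N0 H0] := mulX_iterDop_eq0 m mu x ip.
(* For l + 1 = i the boundary term carries x_{i+1,i}^(mu-N+1), hence a bound for mu + 1. *)
have [N4 H4] := mulX_iterDop_eq0 m (mu + 1) x ip.
pose N := (N0 + N1 + N2 + N3 + N4)%N.
rewrite (trunc N); last by rewrite /N; lia.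
have [->|li] := eqVneq l i.
  rewrite raiseX_trunc // seriesZ H0 ?mulr0 //; last by rewrite /N; lia.
  by move=> e'; rewrite diagE mulf_eq0 negb_or => /andP[_ /H].
rewrite raiseX_trunc_neq // seriesZ addrAC.
have [E|ne] := eqVneq l.+1 i; last by rewrite mulr0 mul0r.
rewrite H4 ?mulr0 //; last by rewrite /N; lia.
apply: A1_partial => //; rewrite mem_lowpos -E; lia.
Qed.

End Eta.

(** * Solutions and their weights *)

Section Singular.
Context {C : numFieldType} (n : nat) (Lam : nat -> C).
Implicit Types (f g : series C) (e : expo C) (m w : nat -> C).
Local Notation raiseX := (raiseX n Lam).
Local Notation glwt := (glwt n Lam).

Definition has_weight w f :=
  forall e, f e != 0 -> forall k, (0 < k <= n)%N -> glwt k e = w k.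

Definition swap i m : nat -> C :=
  fun k => if k == i then m i.+1 else if k == i.+1 then m i else m k.

(** For a monomial in the x_{k+1,k} alone, E_{k,k}-weight m k + k means e_{k+1,k} - e_{k,k-1} = Lam
    k - k - m k. Summing leaves this exponent as the only candidate. *)
Definition lead_exp m : expo C := fun i j =>
  if [&& (0 < j)%N, (j < n)%N & i == j.+1]
  then \sum_(1 <= k < j.+1) (Lam k - k%:R - m k) else 0.

(* [m] is the weight shifted by rho = (-1, ..., -n), on which the Weyl group acts
   by permutations. *)
Record singular_series m f : Prop := SingularSeries {
  ss_A1 : in_A1 n f;
  ss_weight : has_weight (fun k => m k + k%:R) f;
  ss_raise : forall l, (0 < l < n)%N -> raiseX l f = 0;
  ss_lead : f (lead_exp m) = 1 }.

Lemma glwt_shift k x y c e : (0 < y < x)%N -> (x <= n)%N -> (0 < k)%N ->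
  glwt k (shift x y c e) = glwt k e + ((k == x)%:R - (k == y)%:R) * c.
Proof.
move=> yx xn k0; rewrite /glwt sum_shift_col.
have -> : ((k < x < n.+1)%N && (k == y)) = (k == y) by lia.
suff -> : \sum_(1 <= b < k) shift x y c e k b =
  \sum_(1 <= b < k) e k b + (k == x)%:R * c by ring.
have [->|ne] := eqVneq k x; last first.
  rewrite mul0r addr0; apply: eq_bigr => b _.
  by rewrite shift_neq // xpair_eqE negb_and ne.
rewrite -[_ * c]/(_ *: (c : C^o)).
have -> : true%:R *: (c : C^o) = \sum_(1 <= b < x) (b == y)%:R *: (c : C^o).
  by rewrite (sum_delta 1 x y (fun=> c : C^o)) yx.
rewrite -big_split; apply: eq_bigr => b _ /=.
by rewrite /shift eqxx /=; case: eqP; rewrite ?scale1r ?scale0r ?addr0.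
Qed.

Lemma has_weight_Dop i w f : (0 < i < n)%N -> has_weight w f ->
  has_weight (fun k => w k + ((k == i.+1)%:R - (k == i)%:R)) (Dop i f).
Proof.
move=> ip H e De k kn.
have [j ji] : exists2 j, (0 < j < i)%N & vecX (i.+1, j) (i, j) f e != 0.
  apply: contrapT => nex; move/negP: De; apply; apply/eqP.
  rewrite DopE series_sum big_nat big1 // => j ji.
  by apply: contrapT => /eqP Tj; apply: nex; exists j.
rewrite vecXE mulXE partialXE mulf_eq0 negb_or => /andP[_ /H/(_ k kn) <-].
by rewrite !glwt_shift //=; [ring|lia..].
Qed.

Lemma has_weight_eta i c w f : (0 < i < n)%N -> has_weight w f ->
  has_weight (fun k => w k + ((k == i.+1)%:R - (k == i)%:R) * c) (eta i c f).
Proof.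
move=> ip H e /eta_neq0[p]; rewrite eta_termE seriesZ mulf_eq0 negb_or.
case/andP=> _ Dp k kn.
have Hp : has_weight (fun k => w k + ((k == i.+1)%:R - (k == i)%:R) * p%:R)
    (iter p (Dop i) f).
  elim: p {Dp} => [|p IH] e' fe' k' kn'; first by rewrite mulr0 addr0; exact: H.
  have := has_weight_Dop ip IH fe' kn'; rewrite /= => ->.
  by rewrite -natr1; ring.
move: Dp; rewrite mulXE => /Hp/(_ k kn); rewrite glwt_shift //=; [|lia..].
move=> E; rewrite -[LHS](addrK (((k == i.+1)%:R - (k == i)%:R) * - (c - p%:R))).
by rewrite E; ring.
Qed.

(** Partial sums that stop before i, or include both i and i + 1, do not see the swap. *)
Lemma lead_exp_swap i m : (0 < i < n)%N ->
  lead_exp (swap i m) = shift i.+1 i (m i - m i.+1) (lead_exp m).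
Proof.
move=> ip; apply/funext => a; apply/funext => b; rewrite /shift /lead_exp.
have [[b0 bn /eqP->]|nin] := and3P; last first.
  case: ifP => // /andP[/eqP ai /eqP bi]; case: nin; split; lia.
rewrite eqSS.
have below j : (j <= i)%N -> \sum_(1 <= k < j) (Lam k - k%:R - swap i m k) =
    \sum_(1 <= k < j) (Lam k - k%:R - m k).
  move=> ji; rewrite big_nat [RHS]big_nat; apply: eq_bigr => k kj.
  by rewrite /swap !ltn_eqF //; lia.
have rec j (F : nat -> C) : (0 < j)%N ->
    \sum_(1 <= k < j.+1) F k = \sum_(1 <= k < j) F k + F j.
  by move=> j0; rewrite big_nat_recr.
have at_i : \sum_(1 <= k < i.+1) (Lam k - k%:R - swap i m k) =
    \sum_(1 <= k < i.+1) (Lam k - k%:R - m k) + (m i - m i.+1).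
  rewrite !rec; [|lia..]; rewrite below // /swap eqxx; ring.
have above d : \sum_(1 <= k < (i + d).+2) (Lam k - k%:R - swap i m k) =
    \sum_(1 <= k < (i + d).+2) (Lam k - k%:R - m k).
  elim: d => [|d IH].
    rewrite addn0 rec // at_i [RHS]rec // /swap eqxx gtn_eqF //; ring.
  rewrite addnS rec // IH [RHS]rec // /swap !gtn_eqF //; lia.
have [->|ne] := eqVneq b i; first exact: at_i.
have [bi|bi] := leqP b.+1 i; first exact: below.
have -> : b = (i + (b - i).-1).+1 by lia.
exact: above.
Qed.

(** Off the first subdiagonal exponents are naturals, so multiplication by x_{i+1,j} leaves a
    nonzero one. Hence only the term p = 0 of eta contributes to the leading coefficient. *)
Lemma Dop_support p (mu : 'I_p -> nat -> C) i f e : (0 < i < n)%N ->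
  A1_exponents n mu f -> Dop i f e != 0 ->
  exists2 j, (0 < j < i)%N & e i.+1 j != 0.
Proof.
move=> ip H De.
have [j ji] : exists2 j, (0 < j < i)%N & vecX (i.+1, j) (i, j) f e != 0.
  apply: contrapT => nex; move/negP: De; apply; apply/eqP.
  rewrite DopE series_sum big_nat big1 // => j ji.
  by apply: contrapT => /eqP Tj; apply: nex; exists j.
rewrite vecXE mulXE partialXE mulf_eq0 negb_or => /andP[_ /H[_ /(_ i.+1 j)]].
move=> /(_ ltac:(lia)) [d].
rewrite shift_neq /= ?shift_at; last by rewrite xpair_eqE; lia.
move=> E _; exists j => //; apply/eqP => e0; move: E; rewrite e0 add0r => /eqP.
by rewrite eq_sym -subr_eq0 opprK natr1 pnatr_eq0.
Qed.

Lemma eta_lead i m f : (0 < i < n)%N -> in_A1 n f ->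
  eta i (m i - m i.+1) f (lead_exp (swap i m)) = f (lead_exp m).
Proof.
move=> ip [[p [mu [_ H]]] _]; set c := m i - m i.+1.
set e := lead_exp _.
have [N0 H0] := eta_trunc_eq c (e i.+1 i) ip H.
(* One more than the bound, so that the term p = 0 is present. *)
rewrite (H0 N0.+1) // /eta_trunc big_ord_recl !seriesD series_sum.
rewrite eta_termE seriesZ /= mulXE subr0 /falling big_ord0 fact0 divr1 mul1r.
rewrite /e lead_exp_swap // shiftD addNr shift0 big1 ?addr0 // => r _.
rewrite eta_termE seriesZ mulXE; apply/eqP; rewrite mulf_eq0; apply/orP; right.
rewrite /bump leq0n add1n iterS shiftD; apply/negPn/negP.
case/(Dop_support ip (A1_iterDop (r := r) ip H)) => j ji.
rewrite shift_neq /lead_exp; last by rewrite xpair_eqE; lia.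
by rewrite [i.+1 == j.+1]gtn_eqF ?andbF ?eqxx //; lia.
Qed.

(** The rho-shift makes the h_i-weight m i - m i.+1 - 1, so the exponent demanded by [raiseX_eta] is
    the one that exchanges the two entries. *)
Lemma eta_singular i m f : (0 < i < n)%N -> singular_series m f ->
  singular_series (swap i m) (eta i (m i - m i.+1) f).
Proof.
move=> ip [fA fw fr fl]; split.
- exact: eta_A1.
- move=> e fe k kn; rewrite (has_weight_eta ip fw fe kn) /swap.
  have [->|ki] := eqVneq k i.
    by rewrite ltn_eqF //=; ring.
  by have [->|_] := eqVneq k i.+1; rewrite /=; ring.
- move=> l /[dup] ln /andP[l0 _]; apply: raiseX_eta => //; try exact: fr.
  move=> e /fw H; rewrite !H; [rewrite -natr1; ring|lia..].
- by rewrite eta_lead.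
Qed.

Lemma glwt_one k : glwt k (fun _ _ => 0) = Lam k.
Proof. by rewrite /glwt !big1 // addr0 subr0. Qed.

Lemma one_singular : singular_series (fun k => Lam k - k%:R) (@one_series C).
Proof.
have E e : one_series e != 0 :> C -> e = fun _ _ => 0.
  by rewrite /one_series /monomial; case: asboolP; rewrite ?eqxx.
split.
- exact: one_A1.
- by move=> e /E -> k kn; rewrite glwt_one subrK.
- move=> l ln; apply/funext => e; rewrite series0.
  have P0 x y : partialX x y (@one_series C) = 0.
    apply/funext => e'; rewrite partialXE series0; apply/eqP.
    rewrite mulf_eq0 -implyNb; apply/implyP => ne; apply/negPn/negP => /E.
    move/(congr1 (fun e => e x y)); rewrite shift_at => e1.
    by rewrite e1 eqxx in ne.
  rewrite /raiseX P0 raddf0 !big1 ?subr0 ?addr0 ?series0 // => b _;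
    by rewrite vecXE P0 raddf0.
- rewrite /one_series /monomial; case: asboolP => // -[].
  apply/funext => i; apply/funext => j; rewrite /lead_exp.
  by case: ifP => // _; rewrite big1 // => k _; rewrite subrr.
Qed.

End Singular.

(** * Uniqueness of solutions of given weight *)

Section Uniqueness.
Context {C : numFieldType} (n : nat) (Lam : nat -> C).
Implicit Types (f g : series C) (e : expo C) (m w : nat -> C).
Local Notation raiseX := (raiseX n Lam).
Local Notation glwt := (glwt n Lam).

Definition A0_polynomial f := forall e, f e != 0 ->
  (forall i j, (i, j) \notin lowpos n -> e i j = 0) /\
  (forall i j, (j.+1 < i)%N -> exists d : nat, e i j = d%:R).

(* Induction on the last row [a] in which x^e has a variable x_{a,l}, l < a - 1,
   and on the degree of x^e in the variables of that row, where x_{a,j} has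
   degree a - 1 - j: the coefficient of x^e * x_{a,l+1} / x_{a,l} in
   E_{l,l+1} f is that of x^e in f, up to a nonzero factor and to coefficients
   that vanish by induction. *)
Lemma raiseX_inj f : A0_polynomial f ->
  (forall l, (0 < l < n)%N -> raiseX l f = 0) ->
  (forall e, f e != 0 -> exists i j, (j.+1 < i)%N /\ e i j != 0) -> f = 0.
Proof.
move=> fA fr fpure.
have posN d : - 1 <> d%:R :> C.
  move=> E; have : d.+1%:R == 0 :> C by rewrite -natr1 -E addNr.
  by rewrite pnatr_eq0.
suff claim a : forall e, f e != 0 ->
    (forall i j, (j.+1 < i)%N -> (a < i)%N -> e i j = 0) -> False.
  apply/funext => e; rewrite series0; apply: contrapT => /eqP /[dup] fe /fA[e0 _].
  apply: (claim n) fe _ => i j ji ni; apply: e0; rewrite mem_lowpos; lia.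
elim: a => [|a IHa] e fe rows.
  by have [i [j [ji /negP[]]]] := fpure e fe; rewrite rows //; lia.
pose om e := \sum_(1 <= j < a.+1) (a - j)%:R * e a.+1 j.
have omN e' : f e' != 0 -> exists k : nat, om e' = k%:R.
  move=> fe'; have [_ eN] := fA _ fe'.
  rewrite /om; elim: (index_iota 1 a.+1) => [|j s [k IH]].
    by exists 0%N; rewrite big_nil.
  rewrite big_cons IH; case: (ltnP j a) => ja.
    have [|d ->] := eN a.+1 j; first by lia.
    by exists ((a - j) * d + k)%N; rewrite natrD natrM.
  by exists k; rewrite (eqP ja) mul0r add0r.
have [k] := omN e fe; elim/ltn_ind: k e fe rows => k IHk e fe rows ek.
have [[l [l0 la el]]|nex] :=
    pselect (exists l, [/\ (0 < l)%N, (l < a)%N & e a.+1 l != 0]); last first.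
  apply: (IHa e fe) => i j ji; rewrite leq_eqVlt => /predU1P[ai|]; last exact: rows.
  apply: contrapT => /eqP eij; apply: nex; exists j; rewrite ai; split => //.
    rewrite lt0n; apply/eqP => j0; case/fA: fe => /(_ i j).
    by rewrite j0 mem_lowpos => /(_ isT) e0; rewrite j0 e0 eqxx in eij.
  by lia.
have an : (a < n)%N.
  rewrite ltnNge; apply/negP => na; case/fA: fe => /(_ a.+1 l) e0 _.
  by move: el; rewrite e0 ?eqxx // mem_lowpos; lia.
pose e' := shift a.+1 l.+1 1 (shift a.+1 l (-1) e).
have e'row i j : i != a.+1 -> e' i j = e i j.
  by move=> ia; rewrite /e' !shift_neq // xpair_eqE negb_and ia.
have om' : om e' = om e - 1.
  pose F j : C^o := (a - j)%:R * ((j == l.+1)%:R - (j == l)%:R).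
  have -> : om e' = om e + \sum_(1 <= j < a.+1) F j.
    rewrite -big_split; apply: eq_bigr => j _ /=; rewrite -mulrDr; congr (_ * _).
    rewrite /e' /shift eqxx /=.
    by case: eqP => _; case: eqP => _; rewrite /=; ring.
  congr (_ + _); under eq_bigr do rewrite /F mulrBr ![(a - _)%:R * _]mulrC.
  rewrite sumrB (sum_delta 1 a.+1 l.+1 (fun j => (a - j)%:R : C^o)).
  rewrite (sum_delta 1 a.+1 l (fun j => (a - j)%:R : C^o)).
  have -> : (0 < l < a.+1)%N by lia.
  have -> : (0 < l.+1 < a.+1)%N by lia.
  rewrite !scale1r; have -> : (a - l = (a - l.+1).+1)%N by lia.
  by rewrite -natr1; ring.
have bad e'' : (forall j, e'' a.+1 j = e' a.+1 j) ->
    (forall i j, (j.+1 < i)%N -> (a.+1 < i)%N -> e'' i j = 0) -> f e'' = 0.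
  move=> row' rows'; apply: contrapT => /eqP fe''.
  have [k' ek'] := omN _ fe''; apply: (IHk k' _ e'' fe'' rows' ek').
  have : om e'' = om e - 1.
    by rewrite -om'; apply: eq_bigr => j _; rewrite row'.
  by rewrite ek' ek => /eqP; rewrite eq_sym subr_eq natr1 eqr_nat => /eqP ->.
have := congr1 (fun g => g e') (fr l ltac:(lia)).
rewrite /= /raiseX !(seriesD, seriesN, series_sum, series0).
have -> : diag (raise_coef n Lam l) (partialX l.+1 l f) e' = 0.
  rewrite diagE partialXE bad ?mulr0 // => [j|i j ji ai].
    by rewrite shift_neq // xpair_eqE; lia.
  rewrite shift_neq ?xpair_eqE; last by lia.
  by rewrite e'row ?rows //; lia.
rewrite big_nat big1 ?addr0 => [|b bl]; last first.
  rewrite vecXE mulXE partialXE /= bad ?mulr0 // => [j|i j ji ai].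
    by rewrite !shift_neq // xpair_eqE; lia.
  rewrite !shift_neq ?xpair_eqE; [|lia..].
  by rewrite e'row ?rows //; lia.
rewrite (bigD1_seq a.+1) ?mem_index_iota ?iota_uniq /=; [|lia|by []].
rewrite big_seq_cond big1 ?addr0 => [|b /andP[]]; last first.
  rewrite mem_index_iota => lb ba; rewrite vecXE mulXE partialXE /=.
  have [ltba|ltab] := ltnP b a.+1.
    rewrite bad ?mulr0 // => [j|i j ji ai].
      by rewrite !shift_neq // xpair_eqE; lia.
    rewrite !shift_neq ?xpair_eqE; [|lia..].
    by rewrite e'row ?rows //; lia.
  (* In a row b > a + 1 the coefficient of f is taken at the exponent -1 of x_{b,l+1}, a variable
     off the first subdiagonal, so it vanishes. *)
  apply/eqP; rewrite mulf_eq0; apply/orP; right; apply/negPn/negP => /fA[_].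
  move=> /(_ b l.+1 ltac:(lia)) [d].
  rewrite shift_neq ?xpair_eqE; last by lia.
  by rewrite shift_at e'row ?rows ?add0r => [/posN|||] //; lia.
rewrite vecXE mulXE partialXE /= add0r => /eqP.
rewrite oppr_eq0 /e' shiftD addNr shift0 shiftD subrr shift0 /shift.
by rewrite !eqxx /= subrK mulf_eq0 (negbTE el) (negbTE fe).
Qed.

(** The difference has coefficient 0 at the only monomial in the x_{k+1,k} that its weight allows,
    so [raiseX_inj] applies to it. *)
Lemma singular_series_uniq m f g : singular_series n Lam m g ->
  A0_polynomial f -> has_weight n Lam (fun k => m k + k%:R) f ->
  (forall l, (0 < l < n)%N -> raiseX l f = 0) ->
  f = f (lead_exp n Lam m) *: g.
Proof.
move=> [gA gw gr gl] fA fw fr; apply/eqP; rewrite -subr_eq0; apply/eqP.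
set h := f - _.
have hsupp e : h e != 0 -> f e != 0 \/ g e != 0.
  rewrite /h !(seriesD, seriesN, seriesZ); have [->|] := eqVneq (f e) 0; last by left.
  by rewrite add0r oppr_eq0 mulf_eq0 negb_or => /andP[_]; right.
have gA0 : A0_polynomial g.
  by case: gA => -[p [mu [_ H]]] _ e /H[].
have hA : A0_polynomial h by move=> e /hsupp[/fA|/gA0].
have hw : has_weight n Lam (fun k => m k + k%:R) h by move=> e /hsupp[/fw|/gw].
apply: raiseX_inj => // [l ln|e he].
  by rewrite /h raddfB /= linearZ /= fr // gr // scaler0 subr0.
apply: contrapT => nex; move/negP: (he); apply.
suff -> : e = lead_exp n Lam m.
  by rewrite /h !(seriesD, seriesN, seriesZ) gl mulr1 subrr.
have [e0 _] := hA e he.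
have epure i j : (j.+1 < i)%N -> e i j = 0.
  by move=> ji; apply: contrapT => /eqP eij; apply: nex; exists i, j.
apply/funext => i; apply/funext => j; rewrite /lead_exp.
have [[j0 jn /eqP->]|nin] := and3P; last first.
  have [ji|] := ltnP j.+1 i; first exact: epure.
  move=> ij; apply: e0; rewrite mem_lowpos; apply/negP => H; case: nin; split; lia.
(* Extended by 0 to k = 0 and k = n, so that the weight equation has one form for all k. *)
pose u k := if (0 < k < n)%N then e k.+1 k else 0.
have wt k : (0 < k <= n)%N -> Lam k - k%:R - m k = u k - u k.-1.
  move=> kn; have <- : glwt k e - k%:R = m k by rewrite (hw e he k kn) addrK.
  have -> : glwt k e = Lam k + u k.-1 - u k.
    rewrite /glwt; congr (_ + _ - _).
      rewrite big_nat (eq_bigr (fun b => (b == k.-1)%:R *: (u k.-1 : C^o))).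
        rewrite -big_nat (sum_delta 1 k k.-1 (fun=> u k.-1 : C^o)) /u.
        case: ifP => k1; last by rewrite scaler0.
        have -> : (0 < k.-1 < k)%N by lia.
        exact: mul1r.
      move=> b bk; have [->|ne] := eqVneq b k.-1.
        by rewrite scale1r /u ifT prednK //; lia.
      by rewrite scale0r epure //; lia.
    rewrite big_nat (eq_bigr (fun a => (a == k.+1)%:R *: (u k : C^o))).
      rewrite -big_nat (sum_delta k.+1 n.+1 k.+1 (fun=> u k : C^o)) /u.
      case: ifP => k1; last by rewrite scaler0.
      have -> : (k < k.+1 < n.+1)%N by lia.
      exact: mul1r.
    move=> b bk; have [->|ne] := eqVneq b k.+1.
      by rewrite scale1r /u ifT //; lia.
    by rewrite scale0r epure //; lia.
  by ring.
have -> : e j.+1 j = u j by rewrite /u j0 jn.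
elim: j j0 jn => // j IH _ jn; rewrite big_nat_recr //= wt; last by lia.
case: j IH jn => [|j] IH jn; first by rewrite big_geq // add0r [u 0.-1]/u subr0.
by rewrite -IH //; [rewrite /=; ring|lia].
Qed.

End Uniqueness.

(** * Polynomials as series *)

Section SeriesOfPoly.
Context {C : numFieldType} (n : nat).
Implicit Types (f g : series C) (e : expo C) (q : polyA C n).

Definition expo_mnm (alpha : 'X_{1..size (lowpos n)}) : expo C :=
  fun i j => (mexp alpha i j)%:R.

Lemma lowpos_uniq : uniq (lowpos n).
Proof.
apply: allpairs_uniq_dep => [|i _|]; rewrite ?iota_uniq //.
by move=> [a b] [c d] _ _ [-> ->].
Qed.

Lemma expo_mnm_inj : injective expo_mnm.
Proof.
move=> a b ab; apply/mnmP => i; pose p := nth (0, 0)%N (lowpos n) i.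
have := congr1 (fun e => e p.1 p.2) ab; rewrite /expo_mnm /mexp /= -surjective_pairing.
rewrite index_uniq ?lowpos_uniq ?ltn_ord // => /eqP.
by rewrite eqr_nat -!mnm_nth => /eqP.
Qed.

Lemma series_of_poly_mnm q alpha : series_of_poly q (expo_mnm alpha) = q@_alpha.
Proof.
rewrite /series_of_poly.
have mono beta : monomial (expo_mnm beta) (expo_mnm alpha) = (beta == alpha)%:R.
  rewrite /monomial; congr (_%:R); congr nat_of_bool; apply/asboolP/eqP.
    by move/expo_mnm_inj.
  by move=> ->.
have [sup|nsup] := boolP (alpha \in msupp q).
  rewrite (bigD1_seq alpha) ?msupp_uniq //= mono eqxx mulr1 big1 ?addr0 //.
  by move=> beta ba; rewrite mono (negbTE ba) mulr0.
rewrite big_seq big1 => [|beta sb]; first by rewrite memN_msupp_eq0.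
rewrite mono; case: eqP sb => [-> sb|]; last by rewrite mulr0.
by rewrite sb in nsup.
Qed.

Lemma series_of_poly_supp q e :
  series_of_poly q e != 0 -> exists alpha, e = expo_mnm alpha.
Proof.
move=> qe; apply: contrapT => nex; move/negP: qe; apply; apply/eqP.
rewrite /series_of_poly big1 // => alpha _; rewrite /monomial.
by case: asboolP => [ea|_]; rewrite ?mulr0 //; case: nex; exists alpha.
Qed.

Lemma series_of_poly_linear : linear (@series_of_poly C n).
Proof.
move=> a p q; apply/funext => e; rewrite !seriesE.
have [[alpha ->]|nex] := pselect (exists alpha, e = expo_mnm alpha).
  by rewrite !series_of_poly_mnm mcoeffD mcoeffZ.
have z (r : polyA C n) : series_of_poly r e = 0.
  by apply: contrapT => /eqP/series_of_poly_supp.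
by rewrite !z mulr0 addr0.
Qed.
HB.instance Definition _ := GRing.isLinear.Build C (polyA C n) (series C) *:%R
  _ series_of_poly_linear.

Lemma series_of_poly_inj : injective (@series_of_poly C n).
Proof.
by move=> p q pq; apply/mpolyP => alpha; rewrite -!series_of_poly_mnm pq.
Qed.

Lemma series_of_polyX alpha : series_of_poly 'X_[alpha] = monomial (expo_mnm alpha).
Proof.
apply/funext => e; rewrite /series_of_poly msuppX big_seq1 mcoeffX eqxx.
by rewrite mul1r.
Qed.

Lemma mexp_out alpha i j : (i, j) \notin lowpos n -> mexp (n := n) alpha i j = 0%N.
Proof.
by move=> ij; rewrite /mexp nth_default // memNindex // size_tuple.
Qed.

Lemma series_of_poly_A0 q : A0_polynomial n (series_of_poly q).
Proof.
move=> e /series_of_poly_supp[alpha ->]; split => i j ij.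
  by rewrite /expo_mnm mexp_out.
by exists (mexp alpha i j).
Qed.

Lemma mulX_monomial x y c (e0 : expo C) :
  mulX x y c (monomial e0) = monomial (shift x y c e0).
Proof.
apply/funext => e; rewrite mulXE /monomial; congr (_%:R); congr nat_of_bool.
apply/asboolP/asboolP => [<-|->]; first by rewrite shiftD subrr shift0.
by rewrite shiftD addNr shift0.
Qed.

Lemma partialX_monomial x y (e0 : expo C) :
  partialX x y (monomial e0) = e0 x y *: monomial (shift x y (-1) e0).
Proof.
apply/funext => e; rewrite partialXE seriesZ /monomial.
case: asboolP => [<-|ne].
  rewrite shift_at shiftD addNr shift0; case: asboolP => //.
case: asboolP => [E|]; rewrite ?mulr0 //; case: ne.
by rewrite E shiftD subrr shift0.
Qed.

End SeriesOfPoly.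

(** * Brackets of raising and lowering operators *)

Section LowerRaise.
Context {C : numFieldType} (n : nat) (Lam : nat -> C).
Implicit Types (f : series C).

(* The operator by which E_{i+1,i} acts on the Verma module *)
Definition lowerX i f : series C := mulX i.+1 i 1 f + Dop i f.

Lemma lowerX_linear i : linear (lowerX i).
Proof. by move=> a f g; rewrite /lowerX !linearP /= scalerDr addrACA. Qed.
HB.instance Definition _ i :=
  GRing.isLinear.Build C (series C) (series C) *:%R _ (lowerX_linear i).

(** The relation [E_{l,l+1}, E_{i+1,i}] = delta_{l,i} h_i on series, which lets [tau_raise] proceed
    by induction from v. *)
Lemma raise_lower l i f : (0 < l < n)%N -> (0 < i < n)%N ->
  raiseX n Lam l (lowerX i f) = lowerX i (raiseX n Lam l f)
  + (l == i)%:R *: diag (fun e => glwt n Lam i e - glwt n Lam i.+1 e) f.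
Proof.
move=> /andP[l0 _] /[dup] ip /andP[_ iN]; rewrite /lowerX raddfD /= raiseX_Dop //.
have [->|ne] := eqVneq l i.
  rewrite raiseX_mulX // subrr mulX0 gtn_eqF // scale0r subr0 !scale1r.
  apply/funext => e; rewrite !(seriesD, diagE) glwt_root //; ring.
rewrite raiseX_mulX_neq // scale0r !addr0 mul1r vecXE /=.
by apply/funext => e; rewrite !(seriesD, seriesN, seriesZ); ring.
Qed.

Lemma glwt_lower i k f : (0 < i < n)%N -> (0 < k)%N ->
  diag (glwt n Lam k) (lowerX i f) = lowerX i (diag (glwt n Lam k) f)
  + ((k == i.+1)%:R - (k == i)%:R) *: lowerX i f.
Proof.
move=> ip k0; set d := _ - _; apply/funext => e.
rewrite /lowerX !(seriesD, seriesZ, diagE) !mulXE !DopE !series_sum.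
rewrite !mulrDr !mulr_sumr addrACA; congr (_ + _).
  rewrite diagE glwt_shift //=; [|lia..]; rewrite -/d; ring.
rewrite -big_split /= !(big_nat _ _ 1 i); apply: eq_bigr => j jin /=.
rewrite !vecXE !mulXE !partialXE /= diagE !glwt_shift //; [|lia..].
by rewrite /d; ring.
Qed.

End LowerRaise.

(** * The action of gl(n) *)

Section GLAction.
Context {C : numFieldType} (n : nat) (M : lmodType C) (act : 'M[C]_n -> M -> M).
Hypothesis hsl : sl_module act.
Implicit Types (u w : M).

Lemma mul_mxunit i j k l : (0 < j <= n)%N ->
  mxunit C n i j *m mxunit C n k l = (j == k)%:R *: mxunit C n i l.
Proof.
move=> jn; apply/matrixP => a b; rewrite !mxE.
have jp : (j.-1 < n)%N by lia.
rewrite (bigD1 (Ordinal jp)) //= !mxE /= prednK ?eqxx; last by lia.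
rewrite big1 ?addr0 => [|c cj]; last first.
  rewrite !mxE [c.+1 == j]negbTE ?andbF ?mul0r //.
  by apply: contraNneq cj => cj; apply/eqP/val_inj; rewrite /= -cj.
rewrite andbT -!natrM !mulnb; congr (nat_of_bool _)%:R.
by case: (_ == i); case: (j == k).
Qed.

Lemma tr_mxunit i j : (0 < i <= n)%N -> \tr (mxunit C n i j) = (i == j)%:R.
Proof.
move=> iN; rewrite /mxtrace; have ip : (i.-1 < n)%N by lia.
rewrite (bigD1 (Ordinal ip)) //= !mxE /= prednK ?eqxx; last by lia.
rewrite big1 ?addr0 // => c ci; rewrite !mxE [c.+1 == i]negbTE //.
by apply: contraNneq ci => ci; apply/eqP/val_inj; rewrite /= -ci.
Qed.

(* This extends the action to gl(n), the identity acting by 0. *)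
Definition slunit i j : 'M[C]_n :=
  mxunit C n i j - ((i == j)%:R / n%:R)%:M.

Definition glact i j u := act (slunit i j) u.

Lemma tr_slunit i j : (0 < i <= n)%N -> \tr (slunit i j) = 0.
Proof.
move=> iN; rewrite /slunit mxtraceD raddfN /= tr_mxunit // mxtrace_scalar.
rewrite -[_ *+ n]mulr_natr divfK ?subrr // pnatr_eq0; lia.
Qed.

Lemma glactE i j : i != j -> glact i j = act (mxunit C n i j).
Proof.
by move=> /negbTE ij; rewrite /glact /slunit ij mul0r raddf0 subr0.
Qed.

Lemma glact_linear i j : (0 < i <= n)%N -> linear (glact i j).
Proof. by move=> iN; apply: (sl_linear_vec hsl); exact: tr_slunit. Qed.

Lemma act0 u : act 0 u = 0.
Proof.
have := sl_linear_mx hsl (-1) u (mxtrace0 _ n) (mxtrace0 _ n).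
by rewrite scaler0 addr0 scaleN1r addNr.
Qed.

Lemma actD X Y u : \tr X = 0 -> \tr Y = 0 -> act (X + Y) u = act X u + act Y u.
Proof.
by move=> X0 Y0; have := sl_linear_mx hsl 1 u X0 Y0; rewrite !scale1r.
Qed.

Lemma actZ a X u : \tr X = 0 -> act (a *: X) u = a *: act X u.
Proof.
move=> X0; have := sl_linear_mx hsl a u X0 (mxtrace0 _ n).
by rewrite act0 !addr0.
Qed.

Lemma glact_comm i j k l u :
  (0 < i <= n)%N -> (0 < j <= n)%N -> (0 < k <= n)%N -> (0 < l <= n)%N ->
  glact i j (glact k l u) - glact k l (glact i j u) =
  (j == k)%:R *: glact i l u - (l == i)%:R *: glact k j u.
Proof.
move=> iN jN kN lN; rewrite /glact -(sl_bracket hsl) ?tr_slunit //.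
have -> : slunit i j *m slunit k l - slunit k l *m slunit i j =
    (j == k)%:R *: slunit i l - (l == i)%:R *: slunit k j.
  rewrite /slunit !mulmxBl !mulmxBr !mul_mxunit // !mul_mx_scalar !mul_scalar_mx.
  rewrite [l == i]eq_sym [k == j]eq_sym; apply/matrixP => a b; rewrite !mxE.
  rewrite -![(_ / _) *+ _]mulr_natr.
  move: (j == k)%:R (i == l)%:R (k == l)%:R (i == j)%:R n%:R^-1
    (a == b)%:R => x1 x2 x3 x4 x5 x6.
  move: (_ && _)%:R => y1; move: (_ && _)%:R => y2; move: (_ && _)%:R => y3.
  by move: (_ && _)%:R => y4; ring.
rewrite actD ?mxtraceZ ?tr_slunit ?mulr0 //; last first.
  by rewrite raddfN /= mxtraceZ tr_slunit // mulr0 oppr0.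
by rewrite -[- (_ *: slunit k j)]scaleNr !actZ ?tr_slunit // scaleNr.
Qed.

Lemma glact_hmx i u : (0 < i < n)%N ->
  act (hmx C n i) u = glact i i u - glact i.+1 i.+1 u.
Proof.
move=> iN; have t1 : \tr (slunit i i) = 0 by apply: tr_slunit; lia.
have t2 : \tr (slunit i.+1 i.+1) = 0 by apply: tr_slunit; lia.
rewrite /glact -[- act _ u]scaleN1r -actZ // -actD ?mxtraceZ ?t2 ?mulr0 //.
congr (act _ u); rewrite /hmx /slunit !eqxx scaleN1r.
by rewrite opprB addrA subrK.
Qed.

Lemma act_sum (r : seq nat) (F : nat -> 'M[C]_n) u :
  (forall k, k \in r -> \tr (F k) = 0) ->
  act (\sum_(k <- r) F k) u = \sum_(k <- r) act (F k) u.
Proof.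
move=> H; suff [] : act (\sum_(k <- r) F k) u = \sum_(k <- r) act (F k) u /\
  \tr (\sum_(k <- r) F k) = 0 by [].
elim: r H => [|k r IH] H; first by rewrite !big_nil act0 mxtrace0.
have [|E T] := IH; first by move=> j jr; apply: H; rewrite inE jr orbT.
have Fk : \tr (F k) = 0 by apply: H; rewrite mem_head.
by rewrite !big_cons actD // E mxtraceD T Fk addr0.
Qed.

(** The h_i determine only differences of the eigenvalues of the [glact k k]; this relation fixes
    the common constant in [glweight]. *)
Lemma sum_glact u : (0 < n)%N -> \sum_(1 <= k < n.+1) glact k k u = 0.
Proof.
move=> n0; rewrite /glact -act_sum => [|k]; last first.
  by rewrite mem_index_iota => kn; rewrite tr_slunit.
rewrite -[RHS](act0 u); congr (act _ u); apply/matrixP => a b.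
rewrite summxE mxE; under eq_bigr do rewrite !mxE eqxx mul1r.
rewrite sumrB big_const_nat iter_addr_0 subSS subn0.
rewrite -mulrnA mulnC mulrnA -[n%:R^-1 *+ n]mulr_natr mulVf ?pnatr_eq0 -?lt0n //.
rewrite (eq_bigr (fun k => (k == a.+1)%:R *: ((b.+1 == a.+1)%:R : C^o))).
  rewrite (sum_delta 1 n.+1 a.+1 (fun=> (b.+1 == a.+1)%:R : C^o)).
  have -> : (0 < a.+1 < n.+1)%N by apply: ltn_ord.
  rewrite scale1r.
  by rewrite eqSS [_ == nat_of_ord a]eq_sym subrr.
move=> k _; have [->|ne] := eqVneq k a.+1; first by rewrite scale1r.
by rewrite scale0r.
Qed.

(* The eigenvalues of the traceless parts of the E_{k,k} on a vector of weight
   [mu] *)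
Definition glweight (mu : nat -> C) k : C :=
  - \sum_(1 <= r < k) mu r
  + (\sum_(1 <= j < n.+1) \sum_(1 <= r < j) mu r) / n%:R.

Lemma glweight_root mu i : (0 < i)%N ->
  glweight mu i - glweight mu i.+1 = mu i.
Proof.
by move=> i0; rewrite /glweight (big_nat_recr i 1) //=; ring.
Qed.

Lemma glact_weight mu u k : weight_vector act mu u -> (0 < k <= n)%N ->
  glact k k u = glweight mu k *: u.
Proof.
move=> uw kn; pose s j := \sum_(1 <= r < j) mu r.
have step j : (0 < j <= n)%N -> glact j j u = glact 1 1 u - s j *: u.
  elim: j => // -[_ _|j IH jn]; first by rewrite /s big_geq // scale0r subr0.
  have /(_ ltac:(lia)) E := IH; have := uw j.+1 ltac:(lia).
  rewrite glact_hmx; last by lia.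
  move/(congr1 (fun x => glact j.+1 j.+1 u - x)).
  rewrite opprB addrCA subrr addr0 => ->; rewrite E.
  by rewrite /s [in RHS]big_nat_recr //= scalerDl opprD addrA.
have := sum_glact u ltac:(lia); rewrite big_nat (eq_bigr _ step) -big_nat.
rewrite sumrB big_const_nat iter_addr_0 subSS subn0 -scaler_suml => /eqP.
rewrite subr_eq0 -scaler_nat => /eqP E.
have n0 : n%:R != 0 :> C by rewrite pnatr_eq0; lia.
rewrite step // -[glact 1 1 u](scale1r) -(mulVf n0) -scalerA E scalerA -scalerBl.
by congr (_ *: _); rewrite /glweight -/(s k) addrC mulrC.
Qed.

End GLAction.

(** * The lowering operators on the Poincare-Birkhoff-Witt basis *)

Section Words.
Context {C : numFieldType} (n : nat) (M : lmodType C) (act : 'M[C]_n -> M -> M).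
Hypothesis hsl : sl_module act.
Implicit Types (u w : M) (p q : nat * nat) (s : seq (nat * nat)).
Implicit Types a b : nat -> nat -> nat.
Local Notation E p := (act (mxunit C n p.1 p.2)).

(** E^alpha over any list of positions, with exponents given by a function on pairs: rows can be
    split off and single exponents changed without handling multinomials. *)
Definition word s a u := foldr (fun p => iter (a p.1 p.2) (E p)) u s.

Definition incr i j a : nat -> nat -> nat :=
  fun x y => if (x == i) && (y == j) then (a x y).+1 else a x y.
Definition decr i j a : nat -> nat -> nat :=
  fun x y => if (x == i) && (y == j) then (a x y).-1 else a x y.

Lemma incr_at i j a : incr i j a i j = (a i j).+1.
Proof. by rewrite /incr !eqxx. Qed.
Lemma decr_at i j a : decr i j a i j = (a i j).-1.
Proof. by rewrite /decr !eqxx. Qed.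
Lemma incr_neq i j a x y : (x, y) != (i, j) -> incr i j a x y = a x y.
Proof. by rewrite xpair_eqE /incr => /negbTE ->. Qed.
Lemma decr_neq i j a x y : (x, y) != (i, j) -> decr i j a x y = a x y.
Proof. by rewrite xpair_eqE /decr => /negbTE ->. Qed.

Definition is_root p := [&& (0 < p.1 <= n)%N, (0 < p.2 <= n)%N & p.1 != p.2].

Lemma E_linear p : is_root p -> linear (E p).
Proof.
by case/and3P=> p1 p2 pp; rewrite -glactE //; apply: glact_linear.
Qed.

Lemma E_comm p q u : is_root p -> is_root q -> p.2 != q.1 -> q.2 != p.1 ->
  E p (E q u) = E q (E p u).
Proof.
case/and3P=> p1 p2 pp /and3P[q1 q2 qq] /negbTE pq /negbTE qp.
apply/eqP; rewrite -subr_eq0 -!glactE // glact_comm // pq qp.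
by rewrite !scale0r subrr.
Qed.

Lemma iter_comm (T U : M -> M) k u : (forall w, T (U w) = U (T w)) ->
  T (iter k U u) = iter k U (T u).
Proof. by move=> TU; elim: k => //= k IH; rewrite TU IH. Qed.

Lemma iter_linear (T : M -> M) k : linear T -> linear (iter k T).
Proof. by move=> TL; elim: k => [|k IH] c u w; rewrite ?iterS ?IH ?TL. Qed.

Lemma word_ext s a b u : (forall p, p \in s -> a p.1 p.2 = b p.1 p.2) ->
  word s a u = word s b u.
Proof.
elim: s => //= p s IH H; rewrite H ?mem_head // IH // => q qs.
by apply: H; rewrite inE qs orbT.
Qed.

Lemma word_cat s t a u : word (s ++ t) a u = word s a (word t a u).
Proof. by rewrite /word foldr_cat. Qed.

Lemma word_linear s a : all is_root s -> linear (word s a).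
Proof.
elim: s => [_|p s IH /= /andP[pr /IH L]] c u w //=.
by rewrite L (iter_linear _ (E_linear pr)).
Qed.

Lemma word_comm s a (T : M -> M) u :
  (forall p w, p \in s -> T (E p w) = E p (T w)) ->
  T (word s a u) = word s a (T u).
Proof.
elim: s => //= p s IH H; rewrite (iter_comm _ _ (fun w => H p w (mem_head _ _))).
by rewrite IH // => q w qs; apply: H; rewrite inE qs orbT.
Qed.

Lemma word_incr s a p u : uniq s -> p \in s ->
  (forall q w, q \in s -> E p (E q w) = E q (E p w)) ->
  E p (word s a u) = word s (incr p.1 p.2 a) u.
Proof.
elim: s => //= q s IH /andP[qs us]; rewrite inE => /predU1P[->|ps] H.
  rewrite incr_at iterS; congr (E q (iter _ _ _)).
  apply: word_ext => r rs; rewrite incr_neq // -!surjective_pairing.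
  by apply: contraNneq qs => <-.
rewrite (iter_comm _ _ (fun w => H q w (mem_head _ _))) IH //; last first.
  by move=> r w rs; apply: H; rewrite inE rs orbT.
rewrite incr_neq // -!surjective_pairing.
by apply: contraNneq qs => ->.
Qed.

(** Since V = [T, U] commutes with U, each of the k factors contributes the same term. *)
Lemma iter_commutator (T U V : M -> M) k u : linear U ->
  (forall w, T (U w) = U (T w) + V w) -> (forall w, U (V w) = V (U w)) ->
  T (iter k U u) = iter k U (T u) + k%:R *: iter k.-1 U (V u).
Proof.
move=> UL TU UV; elim: k => [|k IH]; first by rewrite scale0r addr0.
have U1 := iter_linear 1 UL.
rewrite iterS TU IH -[U (_ + _)]/(iter 1 U _) addrC.
have UD x y : U (x + y) = U x + U y by have := UL 1 x y; rewrite !scale1r.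
have U0 : U 0 = 0 by apply: (addIr (U 0)); rewrite -UD !add0r.
have UZ c x : U (c *: x) = c *: U x by have := UL c x 0; rewrite U0 !addr0.
rewrite /= UD UZ (iter_comm k u (fun w => esym (UV w))) addrC -addrA.
congr (_ + _); case: k {IH} => [|k]; first by rewrite scale0r add0r scale1r.
by rewrite /= -[k.+2%:R]natr1 scalerDl scale1r.
Qed.

(* E_{i+1,i} acts as a derivation on a product of factors E_{i,j} from row [i]. *)
Lemma word_row_lower i js a u : uniq js -> all (fun j => 0 < j < i)%N js ->
  (0 < i < n)%N ->
  E (i.+1, i) (word [seq (i, j) | j <- js] a u) =
  word [seq (i, j) | j <- js] a (E (i.+1, i) u)
  + \sum_(j <- js) (a i j)%:R *:
      word [seq (i, j) | j <- js] (decr i j a) (E (i.+1, j) u).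
Proof.
move=> ujs jsi iN; elim: js ujs jsi => [|j js IH] /=; first by rewrite big_nil addr0.
move=> /andP[jjs ujs] /andP[ji jsi].
have rij k : (0 < k < i)%N -> is_root (i, k) by move=> ki; rewrite /is_root /=; lia.
have rSj k : (0 < k <= i)%N -> is_root (i.+1, k) by move=> ki; rewrite /is_root /=; lia.
have WL b : linear (word [seq (i, k) | k <- js] b).
  apply: word_linear; apply/allP => _ /mapP[k /(allP jsi) kjs ->].
  exact: rij.
have EL := E_linear (rij j ji).
rewrite (@iter_commutator _ _ (E (i.+1, j))) //; last 2 first.
- move=> w; apply/eqP; rewrite addrC -subr_eq; apply/eqP.
  rewrite /= -!glactE; [|lia..]; rewrite glact_comm //; [|lia..].
  by rewrite eqxx scale1r [j == i.+1]ltn_eqF ?scale0r ?subr0 //; lia.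
- by move=> w; apply: (@E_comm (i, j) (i.+1, j)); rewrite ?rij ?rSj //=; lia.
rewrite IH // big_cons /=.
have IL c := iter_linear c EL.
have ID c x y : iter c (E (i, j)) (x + y) = iter c (E (i, j)) x + iter c (E (i, j)) y.
  by have := IL c 1 x y; rewrite !scale1r.
rewrite ID -addrA; congr (_ + _); rewrite addrC; congr (_ + _).
  congr (_ *: _); rewrite decr_at; congr iter.
  rewrite (@word_comm _ _ (E (i.+1, j))); last first.
    move=> p w /mapP[k /(allP jsi) kjs ->].
    by apply: (@E_comm (i.+1, j) (i, k)); rewrite ?rij ?rSj //=; lia.
  apply: word_ext => p /mapP[k kjs ->]; rewrite decr_neq // xpair_eqE eqxx /=.
  by apply: contraNneq jjs => <-.
have IZ c x y : iter c (E (i, j)) (x *: y) = x *: iter c (E (i, j)) y.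
  have I0 : iter c (E (i, j)) 0 = 0.
    by have := IL c (-1) 0 0; rewrite scaler0 addr0 scaleN1r addNr.
  by have := IL c x y 0; rewrite I0 !addr0.
have IS (r : seq nat) (F : nat -> M) c :
    iter c (E (i, j)) (\sum_(k <- r) F k) = \sum_(k <- r) iter c (E (i, j)) (F k).
  elim: r => [|x r IHr]; last by rewrite !big_cons ID IHr.
  by rewrite !big_nil; have := IZ c 0 0; rewrite !scale0r.
rewrite IS big_seq [RHS]big_seq; apply: eq_bigr => k kjs.
rewrite IZ decr_neq // xpair_eqE eqxx /=.
by apply: contraNneq jjs => ->.
Qed.

End Words.

(** * The operators E_{i+1,i} through tau *)

Section Verma.
Context {C : numFieldType} (n : nat) (lam : nat -> C).
Context (M : lmodType C) (act : 'M[C]_n -> M -> M) (v : M).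
Hypothesis n_gt0 : (0 < n)%N.
Hypothesis hM : verma_module lam act v.
Context (tau : {linear M -> polyA C n}).
Hypothesis htau : forall alpha, tau (Epow act alpha v) = 'X_[alpha].
Implicit Types (u w : M) (a : nat -> nat -> nat).

Let hsl := verma_sl hM.
Local Notation E i j := (act (mxunit C n i j)).
Local Notation word := (word act).
Local Notation Lam := (glweight n lam).

Definition tau_series u : series C := series_of_poly (tau u).

Lemma tau_series_linear : linear tau_series.
Proof. by move=> c u w; rewrite /tau_series !linearP. Qed.
HB.instance Definition _ :=
  GRing.isLinear.Build C M (series C) *:%R _ tau_series_linear.

Definition lowrow i : seq (nat * nat) := [seq (i, j) | j <- iota 1 i.-1].

Lemma lowpos_split i : (0 < i < n)%N ->
  lowpos n = flatten (map lowrow (iota 1 i.-1)) ++ lowrow i ++ lowrow i.+1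
             ++ flatten (map lowrow (iota i.+2 (n - i.+1))).
Proof.
move=> iN; have -> : lowpos n = flatten (map lowrow (iota 1 n)).
  by rewrite -[n in iota 1 n]prednK.
have ni : n = (i.-1 + (1 + (1 + (n - i.+1))))%N by lia.
rewrite [in LHS]ni !iotaD /= !map_cat !flatten_cat /=.
have -> : (1 + i.-1 = i)%N by lia.
by rewrite !addn1.
Qed.

Lemma mem_lowrows s p : p \in flatten (map lowrow s) =
  (p.1 \in s) && (0 < p.2 < p.1)%N.
Proof.
apply/flatten_mapP/idP => [[i si /mapP[j]]|].
  by rewrite mem_iota => jin -> /=; rewrite si; lia.
case: p => i j /= /andP[si ji]; exists i => //; apply/mapP; exists j => //.
by rewrite mem_iota; lia.
Qed.

(** E_{i+1,i} passes the rows before i and turns one E_{i,j} of row i into E_{i+1,j}. What reaches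
    row i + 1 is absorbed there, since the factors of that row commute; later rows are untouched. *)
Lemma lower_word i a : (0 < i < n)%N ->
  E i.+1 i (word (lowpos n) a v) =
  word (lowpos n) (incr i.+1 i a) v
  + \sum_(1 <= j < i) (a i j)%:R *:
      word (lowpos n) (incr i.+1 j (decr i j a)) v.
Proof.
move=> iN; rewrite (lowpos_split iN) !word_cat.
under [in RHS]eq_bigr do rewrite !word_cat.
set A := flatten (map lowrow (iota 1 i.-1)).
set B := flatten (map lowrow (iota i.+2 (n - i.+1))).
have memA p : p \in A -> (0 < p.2 < p.1)%N && (p.1 < i)%N.
  by rewrite mem_lowrows mem_iota; lia.
have memB p : p \in B -> (0 < p.2 < p.1)%N && (i.+1 < p.1)%N.
  by rewrite mem_lowrows mem_iota; lia.
have memr k p : p \in lowrow k -> (0 < p.2 < k)%N /\ p.1 = k.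
  by case/mapP=> j; rewrite mem_iota => jk -> /=; split=> //; lia.
have AL b : linear (word A b).
  apply: (word_linear hsl); apply/allP => -[x y] /memA /= pA; rewrite /is_root /=; lia.
rewrite (@word_comm _ _ _ _ A _ (E i.+1 i)); last first.
  move=> [x y] w /memA /= pA; apply: (@E_comm _ _ _ _ hsl (i.+1, i) (x, y));
    rewrite /is_root /=; lia.
have urow k : uniq (lowrow k).
  by rewrite map_inj_uniq ?iota_uniq // => x y [].
have incr_row j w b : (0 < j <= i)%N ->
    E i.+1 j (word (lowrow i.+1) b w) = word (lowrow i.+1) (incr i.+1 j b) w.
  move=> ji; apply: (@word_incr _ _ _ _ _ b (i.+1, j)) => //.
    by apply/mapP; exists j => //; rewrite mem_iota; lia.
  move=> [x y] w' /memr[/= y1 x1]; apply: (@E_comm _ _ _ _ hsl (i.+1, j) (x, y));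
    rewrite /is_root /= ?x1; lia.
rewrite (@word_row_lower _ _ _ _ hsl i (iota 1 i.-1)) ?iota_uniq //; last first.
  by apply/allP => j; rewrite mem_iota; lia.
rewrite /= incr_row; last by lia.
have AD x y b : word A b (x + y) = word A b x + word A b y.
  by have := AL b 1 x y; rewrite !scale1r.
have A0 b : word A b 0 = 0.
  by have := AL b (-1) 0 0; rewrite scaler0 addr0 scaleN1r addNr.
have AZ c x b : word A b (c *: x) = c *: word A b x.
  by have := AL b c x 0; rewrite A0 !addr0.
have AS (r : seq nat) (F : nat -> M) b :
    word A b (\sum_(k <- r) F k) = \sum_(k <- r) word A b (F k).
  by elim: r => [|x r IHr]; rewrite ?big_nil ?big_cons ?A0 // AD IHr.
rewrite AD; congr (_ + _).
  rewrite [in RHS](@word_ext C n M act A _ (a)); last first.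
    by move=> [x y] /memA /= pA; rewrite incr_neq // xpair_eqE; lia.
  rewrite [in RHS](@word_ext C n M act (lowrow i) _ (a)); last first.
    by move=> [x y] /memr[_ /= p1]; rewrite incr_neq // xpair_eqE; lia.
  by rewrite [in RHS](@word_ext C n M act B _ (a)) // => -[x y] /memB /= pB;
     rewrite incr_neq // xpair_eqE; lia.
rewrite AS /index_iota subn1 big_seq [RHS]big_seq.
apply: eq_bigr => j; rewrite mem_iota => ji.
rewrite AZ incr_row; last by lia.
congr (_ *: _).
rewrite [in RHS](@word_ext C n M act A _ (a)); last first.
  by move=> [x y] /memA /= pA; rewrite incr_neq ?decr_neq // xpair_eqE; lia.
rewrite [in RHS](@word_ext C n M act (lowrow i) _ (decr i j a)); last first.
  by move=> [x y] /memr[_ /= p1]; rewrite incr_neq // xpair_eqE; lia.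
rewrite [in RHS](@word_ext C n M act (lowrow i.+1) _ (incr i.+1 j a)); last first.
  move=> [x y] /memr[_ /= ->]; rewrite /incr /decr.
  by rewrite [i.+1 == i]gtn_eqF.
by rewrite [in RHS](@word_ext C n M act B _ (a)) // => -[x y] /memB /= pB;
   rewrite incr_neq ?decr_neq // xpair_eqE; lia.
Qed.

Definition expo_nat a : expo C :=
  fun i j => if (i, j) \in lowpos n then (a i j)%:R else 0.

Lemma tau_word a :
  tau_series (word (lowpos n) a v) = monomial (expo_nat a).
Proof.
pose alpha := [multinom a (nth (0, 0)%N (lowpos n) i).1
                          (nth (0, 0)%N (lowpos n) i).2 | i < size (lowpos n)].
have mexpE i j : (i, j) \in lowpos n -> mexp alpha i j = a i j.
  move=> ij; have lt : (index (i, j) (lowpos n) < size (lowpos n))%N.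
    by rewrite index_mem.
  rewrite /mexp -[index _ _]/(nat_of_ord (Ordinal lt)) -mnm_nth mnmE /=.
  by rewrite nth_index.
have -> : word (lowpos n) a v = Epow act alpha v.
  by apply: (@word_ext C n M act (lowpos n) a (mexp alpha)) => -[i j] /= /mexpE.
rewrite /tau_series htau series_of_polyX; congr monomial.
apply/funext => i; apply/funext => j; rewrite /expo_mnm /expo_nat.
by case: ifP => [/mexpE->//|/negbT ij]; rewrite mexp_out.
Qed.

Lemma verma_span (P : M -> Prop) :
  P 0 -> (forall c u w, P u -> P w -> P (c *: u + w)) ->
  (forall a, P (word (lowpos n) a v)) -> forall u, P u.
Proof.
move=> P0 PL Pw u; have [q [-> _]] := verma_basis hM u.
elim: (msupp q) => [|alpha s IH]; first by rewrite big_nil.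
by rewrite big_cons; apply: PL => //; exact: Pw.
Qed.

Lemma tau_lower i u : (0 < i < n)%N ->
  tau_series (E i.+1 i u) = lowerX i (tau_series u).
Proof.
move=> iN; have EL : linear (E i.+1 i).
  by apply: (@E_linear _ _ _ _ hsl (i.+1, i)); rewrite /is_root /=; lia.
have E0 : E i.+1 i 0 = 0.
  by have := EL (-1) 0 0; rewrite scaler0 addr0 scaleN1r addNr.
elim/verma_span: u => [|c u w IHu IHw|a].
- by rewrite E0 !raddf0.
- by rewrite EL !linearP /= IHu IHw.
rewrite lower_word // linearD linear_sum /= !tau_word /lowerX; congr (_ + _).
  rewrite mulX_monomial; congr monomial; apply/funext => x; apply/funext => y.
  rewrite /expo_nat /shift /incr; case: ifP => xy; case: ifP => // xin.
    by rewrite natr1.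
  case/andP: xin xy => /eqP-> /eqP->; rewrite mem_lowpos; lia.
rewrite DopE big_nat [RHS]big_nat; apply: eq_bigr => j jin.
rewrite linearZ /= tau_word vecXE /= partialX_monomial linearZ /= mulX_monomial.
have ijin : (i, j) \in lowpos n by rewrite mem_lowpos; lia.
have Sijin : (i.+1, j) \in lowpos n by rewrite mem_lowpos; lia.
rewrite {2}/expo_nat ijin.
(* If [a i j] is 0 then [decr] does not lower it, but the coefficient is 0. *)
have [->|a0] := eqVneq (a i j) 0%N; first by rewrite !scale0r.
congr (_ *: monomial _); apply/funext => x; apply/funext => y.
rewrite /shift /expo_nat /incr /decr.
have [/andP[/eqP-> /eqP->]|] := boolP ((x == i.+1) && (y == j)).
  by rewrite Sijin gtn_eqF //= natr1.
have [/andP[/eqP-> /eqP->]|] := boolP ((x == i) && (y == j)) => _ //.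
by rewrite ijin -[in RHS](prednK (n := a i j)) ?lt0n // -natr1 addrK.
Qed.

Lemma tau_v : tau_series v = @one_series C.
Proof.
have -> : v = word (lowpos n) (fun _ _ => 0%N) v by elim: (lowpos n) => //= p s <-.
rewrite tau_word; congr monomial; apply/funext => x; apply/funext => y.
by rewrite /expo_nat if_same.
Qed.

End Verma.

(** * The action of sl(n) by differential operators *)

Section VermaSeries.
Context {C : numFieldType} (n : nat) (lam : nat -> C).
Context (M : lmodType C) (act : 'M[C]_n -> M -> M) (v : M).
Hypothesis n_gt0 : (0 < n)%N.
Hypothesis hM : verma_module lam act v.
Context (tau : {linear M -> polyA C n}).
Hypothesis htau : forall alpha, tau (Epow act alpha v) = 'X_[alpha].
Implicit Types (u w : M) (a : nat -> nat -> nat).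

Let hsl := verma_sl hM.
Local Notation E i j := (act (mxunit C n i j)).
Local Notation Lam := (glweight n lam).
Local Notation S := (tau_series tau).

(** Brackets of the E_{i+1,i} give all E_{i,j} with j < i, so a linear identity on M need only be
    checked on v and propagated along the simple lowering operators, where the relations are
    short. *)
Lemma verma_ind (P : M -> Prop) :
  (forall c u w, P u -> P w -> P (c *: u + w)) -> P v ->
  (forall i u, (0 < i < n)%N -> P u -> P (E i.+1 i u)) -> forall u, P u.
Proof.
move=> PL Pv Pf; have P0 : P 0 by rewrite -(subrr v) addrC -scaleN1r; apply: PL.
have PE d j u : (0 < j)%N -> (j + d < n)%N -> P u -> P (E (j + d).+1 j u).
  elim: d j u => [|d IH] j u j0 jd Pu.
    by rewrite addn0; apply: Pf; rewrite ?j0 //; lia.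
  have -> : E (j + d.+1).+1 j u = E (j + d.+1).+1 j.+1 (E j.+1 j u)
      - E j.+1 j (E (j + d.+1).+1 j.+1 u).
    rewrite -!glactE; [|lia..]; rewrite glact_comm //; [|lia..].
    by rewrite eqxx scale1r [j == _]ltn_eqF ?scale0r ?subr0 //; lia.
  rewrite addrC -scaleN1r addnS -addSn.
  by apply: PL; [apply: Pf; [lia|]|]; apply: IH => //; try lia; apply: Pf => //; lia.
apply: (verma_span hM) => // a.
have : all (is_root n) (lowpos n) /\ forall p, p \in lowpos n -> (0 < p.2 < p.1)%N.
  split; first (apply/allP; case=> i j; rewrite mem_lowpos /is_root /=; lia).
  by case=> i j; rewrite mem_lowpos /=; lia.
have : forall p, p \in lowpos n -> forall w, P w -> P (E p.1 p.2 w).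
  case=> i j; rewrite mem_lowpos /= => ij w Pw.
  have -> : i = (j + (i - j.+1)).+1 by lia.
  by apply: PE => //; lia.
move=> H _; elim: (lowpos n) H => //= p s IH H.
have Ps : P (word act s a v).
  by apply: IH => q qs; apply: H; rewrite inE qs orbT.
elim: (a p.1 p.2) => //= k Pk; apply: H => //; exact: mem_head.
Qed.

Lemma tau_glact k u : (0 < k <= n)%N ->
  S (glact act k k u) = diag (glwt n Lam k) (S u).
Proof.
move=> kn; have gL := glact_linear hsl k kn.
elim/verma_ind: u => [c u w IHu IHw||i u iN IH].
- by rewrite gL !linearP /= IHu IHw.
- rewrite (glact_weight hsl (verma_weight hM) kn) linearZ /= (tau_v htau).
  apply/funext => e; rewrite seriesZ diagE /one_series /monomial.
  by case: asboolP => [->|_]; rewrite ?mulr0 // glwt_one.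
have fE : glact act i.+1 i = E i.+1 i by rewrite glactE //; lia.
have -> : glact act k k (E i.+1 i u) = E i.+1 i (glact act k k u)
    + ((k == i.+1)%:R - (k == i)%:R) *: E i.+1 i u.
  apply/eqP; rewrite addrC -subr_eq; apply/eqP; rewrite -fE glact_comm //; [|lia..].
  rewrite scalerBl [i == k]eq_sym; congr (_ - _).
    by have [->|] := eqVneq k i.+1; rewrite ?scale0r.
  by have [->|] := eqVneq k i; rewrite ?scale0r.
by rewrite linearD linearZ /= !(tau_lower n_gt0 hM htau) // IH glwt_lower //; lia.
Qed.

Lemma tau_raise l u : (0 < l < n)%N -> S (E l l.+1 u) = raiseX n Lam l (S u).
Proof.
move=> ln; have EL : linear (E l l.+1).
  by apply: (@E_linear _ _ _ _ hsl (l, l.+1)); rewrite /is_root /=; lia.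
elim/verma_ind: u => [c u w IHu IHw||i u iN IH].
- by rewrite EL !linearP /= IHu IHw.
- rewrite (verma_highest hM) ?raddf0; [|lia..].
  by rewrite (tau_v htau) (ss_raise (one_singular n Lam)).
have -> : E l l.+1 (E i.+1 i u) = E i.+1 i (E l l.+1 u)
    + (l == i)%:R *: (glact act i i u - glact act i.+1 i.+1 u).
  apply/eqP; rewrite addrC -subr_eq; apply/eqP.
  rewrite -!glactE; [|lia..]; rewrite glact_comm //; [|lia..].
  rewrite eqSS [i == l]eq_sym.
  by have [->|] := eqVneq l i; rewrite ?scale0r ?subr0 ?scale1r.
rewrite linearD linearZ linearB /= (tau_lower n_gt0 hM htau) // IH.
rewrite (tau_lower n_gt0 hM htau) // !tau_glact; [|lia..].
rewrite raise_lower //; congr (_ + _ *: _).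
by apply/funext => e; rewrite seriesD seriesN !diagE -mulrBl.
Qed.

Lemma tau_inj : injective tau.
Proof.
have key u q : u = \sum_(alpha <- msupp q) q@_alpha *: Epow act alpha v -> tau u = q.
  move=> ->; rewrite linear_sum [RHS]mpolyE; apply: eq_bigr => alpha _.
  by rewrite linearZ /= htau.
move=> u w uw; have [q [uq _]] := verma_basis hM u.
have [r [wr _]] := verma_basis hM w.
by rewrite uq wr -(key u q uq) -(key w r wr) uw.
Qed.

Lemma tau_series_inj : injective S.
Proof. by move=> u w /series_of_poly_inj/tau_inj. Qed.

Lemma singular_tau_weight u mu : weight_vector act mu u ->
  has_weight n Lam (glweight n mu) (S u).
Proof.
move=> uw e ue k kn; have := tau_glact u kn.
rewrite (glact_weight hsl uw kn) linearZ /= => /(congr1 (fun f => f e)).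
by rewrite seriesZ diagE => /(mulIf ue).
Qed.

Lemma tau_weight_vector u m : has_weight n Lam m (S u) ->
  weight_vector act (fun i => m i - m i.+1) u.
Proof.
move=> uw i iN; apply: tau_series_inj; rewrite glact_hmx // linearB linearZ /=.
rewrite !tau_glact; [|lia..]; apply/funext => e.
rewrite seriesD seriesN seriesZ !diagE -mulrBl.
have [->|ue] := eqVneq (S u e) 0; first by rewrite !mulr0.
by rewrite !(uw e ue); [|lia..].
Qed.

Lemma singular_highest u : (forall i, (0 < i < n)%N -> E i i.+1 u = 0) ->
  forall i j, (0 < i < j)%N -> (j <= n)%N -> glact act i j u = 0.
Proof.
move=> u0 i j ij jn.
have -> : j = (i + (j - i.+1)).+1 by lia.
have {ij jn} : (0 < i)%N /\ (i + (j - i.+1) < n)%N by lia.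
elim: (j - i.+1)%N => [|d IH] [i0 iN].
  by rewrite addn0 in iN *; rewrite glactE ?u0 ?i0 //; lia.
rewrite addnS in iN *; have g0 x y : (0 < x <= n)%N -> glact act x y 0 = 0.
  move=> xn; have := glact_linear hsl y xn (-1) 0 0.
  by rewrite scaler0 addr0 scaleN1r addNr.
have := @glact_comm _ _ _ _ hsl i (i + d).+1 (i + d).+1 (i + d).+2 u
  ltac:(lia) ltac:(lia) ltac:(lia) ltac:(lia).
rewrite IH ?g0; [|lia..].
have -> : glact act (i + d).+1 (i + d).+2 u = 0 by rewrite glactE ?u0 //; lia.
rewrite g0; last by lia.
rewrite subrr eqxx scale1r gtn_eqF ?scale0r ?subr0 //; lia.
Qed.

End VermaSeries.

(** * Gelfand invariants and the weights of singular vectors *)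

Section Gelfand.
Context {C : numFieldType} (n : nat) (M : lmodType C) (act : 'M[C]_n -> M -> M).
Hypothesis hsl : sl_module act.
Implicit Types (u w : M) (m : nat -> C).
Local Notation g := (glact act).

(* The entry (i, j) of the k-th power of the matrix of the E_{i,j} *)
Fixpoint gelfand k i j u : M :=
  if k is k'.+1 then \sum_(1 <= c < n.+1) g i c (gelfand k' c j u)
  else (i == j)%:R *: u.

Lemma glactD i j u w : (0 < i <= n)%N -> g i j (u + w) = g i j u + g i j w.
Proof. by move=> iN; have := glact_linear hsl j iN 1 u w; rewrite !scale1r. Qed.

Lemma glact0 i j : (0 < i <= n)%N -> g i j 0 = 0.
Proof.
move=> iN; have := glact_linear hsl j iN (-1) 0 0.
by rewrite scaler0 addr0 scaleN1r addNr.
Qed.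

Lemma glactZ i j c u : (0 < i <= n)%N -> g i j (c *: u) = c *: g i j u.
Proof.
by move=> iN; have := glact_linear hsl j iN c u 0; rewrite glact0 // !addr0.
Qed.

Lemma glactN i j u : (0 < i <= n)%N -> g i j (- u) = - g i j u.
Proof. by move=> iN; rewrite -scaleN1r glactZ // scaleN1r. Qed.

Lemma glact_sum i j (r : seq nat) (F : nat -> M) : (0 < i <= n)%N ->
  g i j (\sum_(k <- r) F k) = \sum_(k <- r) g i j (F k).
Proof.
move=> iN; elim: r => [|x r IH]; first by rewrite !big_nil glact0.
by rewrite !big_cons glactD // IH.
Qed.

Lemma gelfand_linear k i j : (0 < i <= n)%N -> linear (gelfand k i j).
Proof.
elim: k i => [|k IH] i iN c u w /=.
  by rewrite scalerDr !scalerA mulrC.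
rewrite scaler_sumr -big_split big_nat [RHS]big_nat; apply: eq_bigr => d dn.
by rewrite IH //= glactD // glactZ.
Qed.

(** The entries of the k-th power transform under brackets like the E_{i,j} themselves. On the
    diagonal the two terms sum to the same value, which makes [casimir k] commute with the
    action. *)
Lemma gelfand_comm k a b i j u :
  (0 < a <= n)%N -> (0 < b <= n)%N -> (0 < i <= n)%N -> (0 < j <= n)%N ->
  g a b (gelfand k i j u) - gelfand k i j (g a b u) =
  (b == i)%:R *: gelfand k a j u - (j == a)%:R *: gelfand k i b u.
Proof.
elim: k i => [|k IH] i an bn iN jn /=.
  rewrite glactZ // subrr !scalerA -!natrM !mulnb [i == b]eq_sym [a == j]eq_sym.
  by rewrite [(b == i) && _]andbC subrr.
have step c : (0 < c < n.+1)%N ->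
    g a b (g i c (gelfand k c j u)) - g i c (gelfand k c j (g a b u)) =
    (b == i)%:R *: g a c (gelfand k c j u)
    - (c == a)%:R *: g i b (gelfand k c j u)
    + ((c == b)%:R *: g i c (gelfand k a j u)
       - (j == a)%:R *: g i c (gelfand k c b u)).
  move=> cn; have := glact_comm hsl (gelfand k c j u) an bn iN cn.
  move/eqP; rewrite subr_eq => /eqP ->; rewrite -addrA; congr (_ + _).
  have /eqP := IH c an bn cn jn; rewrite subr_eq => /eqP ->.
  rewrite glactD // glactD // glactN // !glactZ // [b == c]eq_sym.
  by rewrite addrK.
rewrite glact_sum // -sumrB (eq_big_nat _ _ step).
rewrite big_split !sumrB /= -!scaler_sumr.
rewrite (sum_delta 1 n.+1 a (fun c => g i b (gelfand k c j u))).
rewrite (sum_delta 1 n.+1 b (fun c => g i c (gelfand k a j u))).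
by rewrite !ltnS an bn !scale1r addrA subrK.
Qed.

Lemma gelfand0 k i j : (0 < i <= n)%N -> gelfand k i j 0 = 0.
Proof.
move=> iN; have := gelfand_linear k j iN (-1) 0 0.
by rewrite scaler0 addr0 scaleN1r addNr.
Qed.

Definition casimir k u := \sum_(1 <= a < n.+1) gelfand k a a u.

Lemma casimir_comm k a b u : (0 < a <= n)%N -> (0 < b <= n)%N ->
  g a b (casimir k u) = casimir k (g a b u).
Proof.
move=> an bn; apply/eqP; rewrite -subr_eq0 glact_sum // -sumrB.
rewrite (eq_big_nat _ _ (fun i (iN : (0 < i < n.+1)%N) =>
  gelfand_comm k u an bn iN iN)).
rewrite sumrB; under eq_bigr do rewrite eq_sym.
rewrite (sum_delta 1 n.+1 b (fun c => gelfand k a c u)).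
rewrite (sum_delta 1 n.+1 a (fun c => gelfand k c b u)).
by rewrite !ltnS an bn subrr.
Qed.

(** This is (E^(k+1))_{a,a} = sum_c E_{a,c} (E^k)_{c,a} on a highest weight vector: c < a gives 0, c
    = a gives m a times (E^k)_{a,a}, and each of the n - a values c > a gives the bracket
    (E^k)_{a,a} - (E^k)_{c,c}. *)
Fixpoint gelfand_eigen m k a : C :=
  if k is k'.+1 then (m a + (n - a)%:R) * gelfand_eigen m k' a
                     - \sum_(a.+1 <= b < n.+1) gelfand_eigen m k' b
  else 1.

Lemma gelfand_highest m k w :
  (forall i j, (0 < i < j)%N -> (j <= n)%N -> g i j w = 0) ->
  (forall i, (0 < i <= n)%N -> g i i w = m i *: w) ->
  (forall a b, (0 < a < b)%N -> (b <= n)%N -> gelfand k a b w = 0) /\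
  (forall a, (0 < a <= n)%N -> gelfand k a a w = gelfand_eigen m k a *: w).
Proof.
move=> w0 wm; elim: k => [|k [IHu IHd]].
  split=> [a b ab bn|a an] /=; last by rewrite eqxx.
  by rewrite ltn_eqF ?scale0r //; lia.
have up a b c : (0 < a <= b)%N -> (b <= n)%N -> (0 < c < b)%N -> gelfand k c b w = 0.
  by move=> ab bn cb; apply: IHu; lia.
have comm a b c : (0 < a <= b)%N -> (b <= n)%N -> (a < c <= n)%N ->
    g a c (gelfand k c b w) = gelfand k a b w - (b == a)%:R *: gelfand k c c w.
  move=> ab bn ac; have cn : (0 < c <= n)%N by lia.
  have := @gelfand_comm k a c c b w ltac:(lia) cn cn ltac:(lia).
  rewrite eqxx scale1r [g a c w]w0; [|lia..].
  by rewrite gelfand0 // subr0.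
have low a b c : (0 < a <= b)%N -> (b <= n)%N -> (0 < c < n.+1)%N ->
    (c < a)%N -> g a c (gelfand k c b w) = 0.
  by move=> ab bn cn ca; rewrite (up a) ?glact0 //; lia.
split=> [a b ab bn|a an] /=.
  rewrite big_nat big1 // => c cn; have [ca|ac] := ltnP c b.
    by rewrite (up a) ?glact0 //; lia.
  by rewrite comm; [rewrite IHu // gtn_eqF ?scale0r ?subr0 //; lia|lia..].
rewrite (@big_cat_nat _ _ _ a) /=; [|lia..].
rewrite big_nat big1 ?add0r => [|c ca]; last by rewrite low //; lia.
rewrite big_nat_recl; last by lia.
rewrite IHd // glactZ // wm // scalerA.
rewrite big_add1 /= big_nat (eq_bigr (fun c => (gelfand_eigen m k a
   - gelfand_eigen m k c.+1) *: w)); last first.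
  move=> c ac; rewrite comm ?leqnn ?andbT //; [|lia..].
  by rewrite eqxx scale1r !IHd ?scalerBl //; lia.
rewrite -big_nat -scaler_suml -scalerDl; congr (_ *: _).
by rewrite sumrB big_const_nat iter_addr_0 -mulr_natr; ring.
Qed.

Lemma casimir_highest m k w :
  (forall i j, (0 < i < j)%N -> (j <= n)%N -> g i j w = 0) ->
  (forall i, (0 < i <= n)%N -> g i i w = m i *: w) ->
  casimir k w = (\sum_(1 <= a < n.+1) gelfand_eigen m k a) *: w.
Proof.
move=> w0 wm; have [_ H] := gelfand_highest k w0 wm.
by rewrite /casimir (@eq_big_nat _ _ _ 1 n.+1 _ _ H) scaler_suml.
Qed.

End Gelfand.

(** * The central character of the Verma module *)

Section HarishChandra.
Context {C : numFieldType} (n : nat) (lam : nat -> C).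
Context (M : lmodType C) (act : 'M[C]_n -> M -> M) (v : M).
Hypothesis n_gt0 : (0 < n)%N.
Hypothesis hM : verma_module lam act v.
Let hsl := verma_sl hM.

Lemma casimir_linear k : linear (casimir act k).
Proof.
move=> c u w; rewrite /casimir scaler_sumr -big_split /=.
by apply: eq_big_nat => a an; rewrite (gelfand_linear hsl).
Qed.

Lemma casimir_verma k u : casimir act k u =
  (\sum_(1 <= a < n.+1) gelfand_eigen n (glweight n lam) k a) *: u.
Proof.
elim/(verma_ind n_gt0 hM): u => [c u w IHu IHw||i u iN IH].
- by rewrite casimir_linear IHu IHw scalerDr !scalerA mulrC.
- apply: casimir_highest => // [i j ij jn|i iN].
    by rewrite glactE ?(verma_highest hM) //; lia.
  exact: (glact_weight hsl (verma_weight hM)).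
rewrite -(glactE act (i := i.+1)); last by lia.
by rewrite -casimir_comm ?IH ?(glactZ hsl) //; lia.
Qed.

Lemma singular_casimir mu u k : u != 0 -> weight_vector act mu u ->
  (forall i, (0 < i < n)%N -> act (mxunit C n i i.+1) u = 0) ->
  \sum_(1 <= a < n.+1) gelfand_eigen n (glweight n lam) k a =
  \sum_(1 <= a < n.+1) gelfand_eigen n (glweight n mu) k a.
Proof.
move=> u0 uw us; apply/eqP; rewrite -subr_eq0.
have : (\sum_(1 <= a < n.+1) gelfand_eigen n (glweight n lam) k a
  - \sum_(1 <= a < n.+1) gelfand_eigen n (glweight n mu) k a) *: u == 0.
  rewrite scalerBl -casimir_verma subr_eq0; apply/eqP.
  apply: casimir_highest => // [i j ij jn|i iN].
    exact: (singular_highest n_gt0 hM us).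
  exact: (glact_weight hsl uw).
by rewrite scaler_eq0 (negbTE u0) orbF.
Qed.

End HarishChandra.

(** * From the invariants to the multiset of shifted weights *)

Section Spectrum.
Context {C : numFieldType}.
Implicit Types (x y : C) (s t : seq C).

(** At z the product of the X - x is z^size times the product of the 1 - x X at 1/z, so the two
    products of X - x agree at all positive integers. The sizes must be compared separately because
    x = 0 leaves no trace in 1 - x X. *)
Lemma prod_1subX_inj s t : size s = size t ->
  \prod_(x <- s) (1 - x *: 'X) = \prod_(x <- t) (1 - x *: 'X) -> perm_eq s t.
Proof.
move=> st E; apply: prod_XsubC_eq; apply/eqP; rewrite -subr_eq0; apply/eqP.
set p := _ - _.
have key (r : seq C) (k : nat) : (\prod_(x <- r) ('X - x%:P)).[k.+1%:R] =
    k.+1%:R ^+ size r * (\prod_(x <- r) (1 - x *: 'X)).[k.+1%:R^-1].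
  have e (c z : C) : (1 - c *: 'X).[z] = 1 - c * z by rewrite !hornerE.
  rewrite !horner_prod; elim: r => [|x r IH]; first by rewrite !big_nil mulr1.
  rewrite !big_cons IH hornerXsubC e exprS.
  have k0 : k.+1%:R != 0 :> C by rewrite pnatr_eq0.
  rewrite mulrACA; congr (_ * _).
  by rewrite mulrBr mulr1 mulrCA mulfV // mulr1.
have root_p k : root p k.+1%:R.
  by rewrite /root /p hornerD hornerN !key st E subrr.
apply: (roots_geq_poly_eq0 (rs := [seq k.+1%:R | k <- iota 0 (size p)])).
- by apply/allP => _ /mapP[k _ ->].
- by rewrite map_inj_uniq ?iota_uniq // => i j /eqP; rewrite eqr_nat eqSS => /eqP.
- by rewrite size_map size_iota.
Qed.

(** The difference d of the multiplicities satisfies d(x) = d(x - 1), and d(z - k) = 0 for some k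
    because the lists are finite. *)
Lemma perm_eq_shift s t :
  perm_eq (s ++ [seq x + 1 | x <- t]) (t ++ [seq x + 1 | x <- s]) -> perm_eq s t.
Proof.
move=> st; suff H z : count_mem z s = count_mem z t.
  by apply/allP => z _; rewrite /= H.
have cS r x : count_mem x [seq y + 1 | y <- r] = count_mem (x - 1) r.
  by rewrite count_map; apply: eq_count => y /=; rewrite eq_sym -subr_eq eq_sym.
have step x : (count_mem x s + count_mem (x - 1)%R t =
               count_mem x t + count_mem (x - 1)%R s)%N.
  by have /seq.permP/(_ (pred1 x)) := st; rewrite !count_cat !cS.
have [k kst] : exists k : nat, z - k%:R \notin s ++ t.
  apply: contrapT => nex.
  pose L := [seq z - k%:R | k <- iota 0 (size (s ++ t)).+1].
  have uL : uniq L.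
    rewrite map_inj_uniq ?iota_uniq // => i j /addrI/oppr_inj/eqP.
    by rewrite eqr_nat => /eqP.
  have sL : {subset L <= s ++ t}.
    move=> _ /mapP[k _ ->]; apply: contrapT => /negP kst; apply: nex.
    by exists k.
  by have := uniq_leq_size uL sL; rewrite size_map size_iota ltnn.
elim: k z kst => [|k IH] z kst.
  move: kst; rewrite subr0 mem_cat negb_or => /andP[zs zt].
  by rewrite !(count_memPn _).
have := step z; rewrite (IH (z - 1)); first by move/addIn.
by have -> : z - 1 - k%:R = z - k.+1%:R by rewrite -natr1; ring.
Qed.

Lemma size_prod_1subX s :
  (size (\prod_(x <- s) (1 - x *: 'X))%R <= (size s).+1)%N.
Proof.
elim: s => [|x s IH]; first by rewrite big_nil size_poly1.
rewrite big_cons; apply: leq_trans (size_polyMleq _ _) _.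
move: IH; set q := bigop _ _ _ => qs /=.
have aux a b d : (a <= 2 -> b <= d.+1 -> (a + b).-1 <= d.+2)%N by lia.
apply: aux qs.
apply: leq_trans (size_polyD _ _) _; rewrite size_polyN size_poly1 geq_max /=.
by apply: leq_trans (size_scale_leq _ _) _; rewrite size_polyX.
Qed.

Context (n : nat).
Implicit Types m : nat -> C.
Local Notation spec m := [seq m a + (n - a)%:R | a <- index_iota 1 n.+1].

(* The truncated generating polynomial sig_a of the gelfand_eigen m k a satisfies
   (1 - x_a X) sig_a = 1 - X sum_(b > a) sig_b modulo X^(N+1), x_a = m a + (n - a),
   hence 1 - X sum_(b >= a) sig_b is multiplied by (1 - (x_a + 1) X) / (1 - x_a X)
   from a + 1 to a. *)
Lemma gelfand_eigen_prod m N : exists r : {poly C},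
  \prod_(x <- spec m) (1 - x *: 'X) *
    (1 - 'X * \poly_(k < N.+1) (\sum_(1 <= a < n.+1) gelfand_eigen n m k a)) =
  \prod_(x <- spec m) (1 - (x + 1) *: 'X) + 'X^(N.+1) * r.
Proof.
pose sig a := \poly_(k < N.+1) gelfand_eigen n m k a.
pose x a := m a + (n - a)%:R.
have -> : \poly_(k < N.+1) (\sum_(1 <= a < n.+1) gelfand_eigen n m k a) =
    \sum_(1 <= a < n.+1) sig a.
  apply/polyP => k; rewrite coef_poly coef_sum.
  case: ifP => kN; first by apply: eq_bigr => a _; rewrite coef_poly kN.
  by rewrite big1 // => a _; rewrite coef_poly kN.
rewrite !big_map.
have rec a : (1 - x a *: 'X) * sig a =
    1 - 'X * (\sum_(a.+1 <= b < n.+1) sig b)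
    - 'X^(N.+1) * (gelfand_eigen n m N.+1 a)%:P.
  apply/polyP => -[|k]; rewrite mulrBl mul1r -scalerAl;
    rewrite !coefB coefZ !coefXM coefXnM coef1 /= coef_poly /=.
    by rewrite mulr0 !subr0.
  rewrite coef_poly coef_sum sub0r subSS coefC ltnS.
  have sigE : (k < N.+1)%N -> \sum_(a.+1 <= b < n.+1) (sig b)`_k =
      \sum_(a.+1 <= b < n.+1) gelfand_eigen n m k b.
    by move=> kN; apply: eq_bigr => b _; rewrite coef_poly kN.
  have [kN|Nk|kN] := ltngtP k N.
  - by rewrite sigE ltnS ltnW //= subr0 -/(x a); ring.
  - rewrite ltnS leqNgt Nk mulr0 subrr big1 ?subr0 ?oppr0 => [|b _].
      by rewrite subn_eq0 leqNgt Nk subr0.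
    by rewrite coef_poly ltnS leqNgt Nk.
  rewrite kN in sigE *.
  by rewrite sigE ltnSn // subnn eqxx /= -/(x a); ring.
suff claim d : (d <= n)%N -> exists r : {poly C},
    \prod_(n.+1 - d <= a < n.+1) (1 - x a *: 'X) *
      (1 - 'X * \sum_(n.+1 - d <= a < n.+1) sig a) =
    \prod_(n.+1 - d <= a < n.+1) (1 - (x a + 1) *: 'X) + 'X^(N.+1) * r.
  by have := claim n (leqnn n); rewrite subSn // subnn.
elim: d => [_|d IH dn].
  by exists 0; rewrite subn0 !big_geq // !mulr0 subr0 addr0 mulr1.
have [r E] := IH (ltnW dn); set a := (n.+1 - d.+1)%N.
have aE : (n.+1 - d = a.+1)%N by rewrite /a; lia.
have an : (a < n.+1)%N by rewrite /a; lia.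
rewrite aE in E; rewrite !(@big_ltn _ _ _ a) //.
exists ((1 - (x a + 1) *: 'X) * r
  + \prod_(a.+1 <= b < n.+1) (1 - x b *: 'X) * ('X * (gelfand_eigen n m N.+1 a)%:P)).
set P := \prod_(a.+1 <= b < n.+1) (1 - x b *: 'X) in E *.
set T := \sum_(a.+1 <= b < n.+1) sig b in E *.
set Q := \prod_(a.+1 <= b < n.+1) (1 - (x b + 1) *: 'X) in E *.
have -> : Q = P * (1 - 'X * T) - 'X^(N.+1) * r by rewrite E addrK.
have -> : (1 - x a *: 'X) * P * (1 - 'X * (sig a + T)) =
   P * ((1 - x a *: 'X) * (1 - 'X * T) - 'X * ((1 - x a *: 'X) * sig a)) by ring.
rewrite rec [(x a + 1) *: 'X]scalerDl scale1r -/T.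
by move: (x a *: 'X) => y; ring.
Qed.

(** Eliminating the common generating polynomial S shows that P Q' - Q P' is divisible by X^(2n+1).
    Its degree is at most 2n, whence the truncation at 2n, so it is 0; [perm_eq_shift] then
    separates the x from the x + 1. *)
Lemma gelfand_eigen_perm m m' :
  (forall k, \sum_(1 <= a < n.+1) gelfand_eigen n m k a =
             \sum_(1 <= a < n.+1) gelfand_eigen n m' k a) ->
  perm_eq (spec m) (spec m').
Proof.
move=> E; apply: perm_eq_shift; apply: prod_1subX_inj.
  by rewrite !size_cat !size_map.
rewrite !big_cat /= !(big_map (fun x => x + 1)) /=.
have [r Er] := gelfand_eigen_prod m (2 * n).
have [r' Er'] := gelfand_eigen_prod m' (2 * n).
move: Er Er'; rewrite (eq_poly _ (fun k _ => E k)).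
set S := 1 - _; set P := \prod_(x <- spec m) _; set Q := \prod_(x <- spec m') _.
set P' := \prod_(x <- spec m) _; set Q' := \prod_(x <- spec m') _ => Er Er'.
apply/eqP; rewrite -subr_eq0; apply/eqP.
have D : P * Q' - Q * P' = 'X^((2 * n).+1) * (Q * r - P * r').
  have -> : P' = P * S - 'X^((2 * n).+1) * r by rewrite Er addrK.
  have -> : Q' = Q * S - 'X^((2 * n).+1) * r' by rewrite Er' addrK.
  ring.
have [r0|r0] := eqVneq (Q * r - P * r') 0; first by rewrite D r0 mulr0.
have : (size (P * Q' - Q * P')%R <= (2 * n).+1)%N.
  apply: leq_trans (size_polyD _ _) _; rewrite size_polyN geq_max.
  have h1 := size_prod_1subX (spec m); have h2 := size_prod_1subX (spec m').
  have h3 := size_prod_1subX [seq x + 1 | x <- spec m].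
  have h4 := size_prod_1subX [seq x + 1 | x <- spec m'].
  move: h1 h2 h3 h4; rewrite 2!(big_map (fun x => x + 1)).
  rewrite -/P -/Q -/P' -/Q' !size_map size_iota subn1 /= => h1 h2 h3 h4.
  have aux a b : (a <= n.+1 -> b <= n.+1 -> (a + b).-1 <= (2 * n).+1)%N by lia.
  by apply/andP; split; apply: leq_trans (size_polyMleq _ _) _; apply: aux.
rewrite D mulrC size_mulXn //.
move: r0; rewrite -size_poly_eq0 -lt0n => r0 le.
have aux a b : (0 < b -> a.+1 + b <= a.+1 -> False)%N by lia.
by case: (aux _ _ r0 le).
Qed.

End Spectrum.

(** * The weights of theta *)

Section Moves.
Context {C : numFieldType}.
Implicit Types (m t : nat -> C) (idx : nat -> nat).

(** The effect of the factors of B_p: the transpositions (i,i+1), ..., (p,p+1) carry entry i to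
    place p + 1. The index 0 leaves m as it is, as p + 1 would. *)
Definition move_last p i m : nat -> C := fun j =>
  if i == 0%N then m j else if (j < i)%N then m j
  else if (j <= p)%N then m j.+1 else if j == p.+1 then m i else m j.

Fixpoint moves idx k m : nat -> C :=
  if k is k'.+1 then moves idx k' (move_last k (idx k) m) else m.

Lemma move_last_above p i m j : (i <= p)%N -> (p.+1 < j)%N -> move_last p i m j = m j.
Proof.
move=> ip pj; rewrite /move_last; case: eqP => // _.
by rewrite !ifF //; lia.
Qed.

Lemma move_last_at p i m : (0 < i <= p)%N -> move_last p i m p.+1 = m i.
Proof.
move=> ip; rewrite /move_last [i == 0%N]gtn_eqF; last by lia.
by rewrite ltnn eqxx ifF //; lia.
Qed.

Lemma move_last_id p m : (0 < p)%N -> move_last p.-1 p m = m.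
Proof.
move=> p0; apply/funext => j; rewrite /move_last [p == 0%N]gtn_eqF //.
case: ltnP => // pj; rewrite ifF; last by lia.
by rewrite prednK //; case: eqP => // ->.
Qed.

Lemma swap_move_last k i m : (0 < i <= k)%N ->
  swap k (move_last k.-1 i m) = move_last k i m.
Proof.
move=> ik; apply/funext => j; rewrite /swap /move_last [i == 0%N]gtn_eqF; last by lia.
have [->|jk] := eqVneq j k.
  by rewrite leqnn !ifF //; lia.
have [->|jk1] := eqVneq j k.+1.
  by rewrite prednK ?eqxx ?ltnn ?ifF //; lia.
case: ltnP => // ij; have [jk'|kj] := leqP j k.
  by rewrite ifT //; lia.
by rewrite !ifF //; lia.
Qed.

Lemma moves_above idx k m j : (forall p, (0 < p <= k)%N -> (idx p <= p)%N) ->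
  (k.+1 < j)%N -> moves idx k m j = m j.
Proof.
elim: k m => //= k IH m adm kj; rewrite IH ?move_last_above //; try lia.
- by apply: adm; lia.
- by move=> p pk; apply: adm; lia.
Qed.

Lemma moves_ext idx idx' k m : (forall p, (0 < p <= k)%N -> idx p = idx' p) ->
  moves idx k m = moves idx' k m.
Proof.
elim: k m => //= k IH m E; rewrite E ?leqnn // IH // => p pk.
by apply: E; lia.
Qed.

Lemma perm_move_last p i m : (i <= p)%N ->
  perm_eq (map (move_last p i m) (iota 1 p.+1)) (map m (iota 1 p.+1)).
Proof.
case: i => [|i] ip; first by rewrite perm_refl.
have pE : p.+1 = (i + ((p - i) + 1))%N by lia.
have -> : map (move_last p i.+1 m) (iota 1 p.+1) =
    map m (iota 1 i) ++ map m (iota i.+2 (p - i)) ++ [:: m i.+1].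
  rewrite [in iota 1 _]pE !iotaD !map_cat; congr (_ ++ (_ ++ _)).
  - apply/eq_in_map => j; rewrite mem_iota => ji; rewrite /move_last /=.
    by rewrite ifT //; lia.
  - have -> : iota i.+2 (p - i) = map (addn 1) (iota (1 + i) (p - i)).
      by rewrite -iotaDl.
    rewrite -map_comp; apply/eq_in_map => j; rewrite mem_iota => ji.
    by rewrite /move_last /= ifF ?ifT //; lia.
  - have -> : (1 + i + (p - i) = p.+1)%N by lia.
    by rewrite /= /move_last /= ltnn eqxx ifF //; lia.
have -> : p.+1 = (i + (1 + (p - i)))%N by lia.
rewrite !iotaD !map_cat perm_cat2l perm_catC /=.
by rewrite addn1.
Qed.

(** Selection from the end: i_p is chosen to put the right value at place p + 1, which the moves
    with smaller p leave alone. *)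
Lemma moves_onto k m t :
  perm_eq (map m (iota 1 k.+1)) (map t (iota 1 k.+1)) ->
  exists idx, (forall p, (0 < p <= k)%N -> (idx p <= p)%N) /\
    forall j, (0 < j <= k.+1)%N -> moves idx k m j = t j.
Proof.
elim: k m t => [|k IH] m t mt.
  exists (fun=> 0%N); split=> [p|j j1]; first by lia.
  have -> : j = 1%N by lia.
  by move/perm_mem/(_ (t 1%N)): mt; rewrite !inE eqxx => /eqP.
have [i ik ti] : exists2 i, (i <= k.+1)%N & move_last k.+1 i m k.+2 = t k.+2.
  have : t k.+2 \in map m (iota 1 k.+2).
    by rewrite (perm_mem mt); apply: map_f; rewrite mem_iota; lia.
  case/mapP=> i; rewrite mem_iota => ik tm.
  (* A value already in place corresponds to the index 0, since k + 2 is not admissible. *)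
  have [ie|ne] := eqVneq i k.+2; first by exists 0%N => //; rewrite tm ie.
  exists i; first by lia.
  by rewrite move_last_at //; lia.
have [idx [adm onto]] : exists idx, (forall p, (0 < p <= k)%N -> (idx p <= p)%N) /\
    forall j, (0 < j <= k.+1)%N -> moves idx k (move_last k.+1 i m) j = t j.
  apply: IH; have := perm_trans (perm_move_last m ik) mt.
  have mapS (f : nat -> C) :
      map f (iota 1 k.+2) = map f (iota 1 k.+1) ++ [:: f k.+2].
    by rewrite -[in LHS](addn1 k.+1) iotaD map_cat.
  by rewrite !mapS ti perm_cat2r.
exists (fun p => if p == k.+1 then i else idx p); split=> [p pk|j jk].
  by case: eqP => [->//|ne]; apply: adm; lia.
rewrite /= eqxx (moves_ext (idx' := idx)) => [|p pk]; last by rewrite ifF //; lia.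
have [->|ne] := eqVneq j k.+2; first by rewrite moves_above.
by apply: onto; lia.
Qed.

End Moves.

Lemma foldr_iotaS (T : Type) (F : nat -> T -> T) z k :
  foldr F z (iota 1 k.+1) = foldr F (F k.+1 z) (iota 1 k).
Proof. by rewrite -[in LHS](addn1 k) iotaD foldr_cat. Qed.

(** * Theta as a solution, and as a polynomial for dominant weights *)

Section Theta.
Context {C : numFieldType} (n : nat) (lam : nat -> C).
Implicit Types (m : nat -> C) (idx : nat -> nat) (f : series C).
Local Notation Lam := (glweight n lam).
Local Notation singular := (singular_series n Lam).

(** lambda^(k) lists the h_j-weights of the current weight, the -1 coming from rho; the entries
    beyond k + 1 are already placed. *)
Definition lam_compat idx k m := forall j, (0 < j <= k)%N ->
  lam_at n lam idx k j = m j - m j.+1 - 1.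

Lemma lam_at_pred idx p : (0 < p < n)%N ->
  lam_at n lam idx p.-1 = lam_step (idx p) (lam_at n lam idx p).
Proof.
move=> pn; rewrite /lam_at; have -> : (n.-1 - p.-1 = (n.-1 - p).+1)%N by lia.
rewrite /=; congr (lam_step (idx _) _); lia.
Qed.

(** Removing entry i_p merges two consecutive gaps, each carrying its own -1: this explains the + 1
    of [lam_step] at j = i_p - 1. *)
Lemma lam_compat_pred idx p m : (0 < p < n)%N -> (idx p <= p)%N ->
  lam_compat idx p m -> lam_compat idx p.-1 (move_last p (idx p) m).
Proof.
move=> pn ip H j jp; rewrite lam_at_pred // /lam_step /move_last.
case: eqP => [_|/eqP i0]; first by apply: H; lia.
have [ji|ij] := ltnP j (idx p).-1.
  by rewrite !ifT; [apply: H|..]; lia.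
have [je|jne] := eqVneq j (idx p).-1.
  rewrite H; last by lia.
  rewrite H; last by lia.
  rewrite ifT; last by lia.
  rewrite ifF; last by lia.
  rewrite ifT; last by lia.
  rewrite je prednK ?lt0n //; ring.
rewrite H; last by lia.
rewrite ifF; last by lia.
rewrite ifT; last by lia.
rewrite ifF; last by lia.
by rewrite ifT //; lia.
Qed.

(** The sum telescopes, and the integer k - i_p + 1 cancels the shifts by -1 of its terms. *)
Lemma theta_expE idx p k m : (0 < idx p <= k)%N -> (k <= p)%N ->
  lam_compat idx p m -> theta_exp n lam idx p k = m (idx p) - m k.+1.
Proof.
move=> ik kp H; rewrite /theta_exp.
rewrite (@eq_big_nat _ _ _ _ _ _ (fun r => (m r - m r.+1) - 1)); last first.
  by move=> r rk; apply: H; lia.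
rewrite sumrB (eq_big_nat _ _ (F2 := fun r => - (m r.+1 - m r))); last first.
  by move=> r _; rewrite opprB.
rewrite sumrN telescope_sumr; last by lia.
rewrite sumr_const_nat; have -> : (k - idx p + 1 = k.+1 - idx p)%N by lia.
ring.
Qed.

(** Stated for a predicate because the factors of B_p are followed twice: for being a solution, and
    for lying in the image of tau. *)
Lemma Bop_ind idx p m f (P : (nat -> C) -> series C -> Prop) :
  (0 < p < n)%N -> (idx p <= p)%N -> lam_compat idx p m -> P m f ->
  (forall k, (0 < idx p <= k)%N -> (k <= p)%N -> forall g,
     P (move_last k.-1 (idx p) m) g ->
     P (move_last k (idx p) m) (eta k (m (idx p) - m k.+1) g)) ->
  P (move_last p (idx p) m) (Bop n lam idx p f).
Proof.
move=> pn ip H Pf step; rewrite /Bop.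
have [i0|i0] := eqVneq (idx p) 0%N.
  by have -> : move_last p (idx p) m = m by rewrite i0; apply/funext.
suff claim d : (d <= p.+1 - idx p)%N -> P (move_last (idx p + d).-1 (idx p) m)
    (foldl (fun g k => eta k (theta_exp n lam idx p k) g) f (iota (idx p) d)).
  by have := claim _ (leqnn _); rewrite subnKC //; lia.
elim: d => [_|d IH dp]; first by rewrite addn0 move_last_id // lt0n.
rewrite -[in iota _ _](addn1 d) iotaD foldl_cat /= (theta_expE _ _ H); [|lia..].
rewrite addnS /=; apply: step; [lia|lia|apply: IH; lia].
Qed.

Lemma Bop_singular idx p m f : (0 < p < n)%N -> (idx p <= p)%N ->
  lam_compat idx p m -> singular m f ->
  singular (move_last p (idx p) m) (Bop n lam idx p f).
Proof.
move=> pn ip H fs; apply: (Bop_ind (P := singular)) => // k ik kp g gs.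
rewrite -swap_move_last //.
(* Before the factor k, the entry m (i_p) stands at place k and place k + 1 is still untouched. *)
have -> : m (idx p) - m k.+1 =
    move_last k.-1 (idx p) m k - move_last k.-1 (idx p) m k.+1.
  rewrite /move_last [idx p == 0%N]gtn_eqF; last by lia.
  have -> : (k < idx p)%N = false by lia.
  have -> : (k <= k.-1)%N = false by lia.
  have -> : (k == k.-1.+1)%N by lia.
  have -> : (k.+1 < idx p)%N = false by lia.
  have -> : (k < k.-1)%N = false by lia.
  by have -> : (k.+1 == k.-1.+1)%N = false by lia.
by apply: eta_singular => //; lia.
Qed.

Lemma theta_singular idx : (0 < n)%N -> admissible n idx ->
  singular (moves idx n.-1 (fun k => Lam k - k%:R)) (theta n lam idx).
Proof.
move=> n0 adm; rewrite /theta.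
suff claim k m f : (k < n)%N -> lam_compat idx k m -> singular m f ->
    singular (moves idx k m) (foldr (Bop n lam idx) f (iota 1 k)).
  apply: claim; [lia| |exact: one_singular].
  move=> j jn; rewrite /lam_at subnn /= -(glweight_root n lam) //; last by lia.
  by rewrite -natr1; ring.
elim: k m f => [//|k IH] m f kn H fs; rewrite foldr_iotaS.
have ik : (idx k.+1 <= k.+1)%N by apply: adm; lia.
by apply: IH; [lia|exact: (lam_compat_pred (p := k.+1))|exact: Bop_singular].
Qed.

Lemma falling_nat (c r : nat) : falling (c%:R : C) r / r`!%:R = 'C(c, r)%:R.
Proof.
have -> : falling (c%:R : C) r = (c ^_ r)%:R.
  rewrite /falling; elim: r => [|r IH]; first by rewrite big_ord0.
  rewrite big_ord_recr /= IH ffactnSr natrM.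
  have [rc|cr] := leqP r c; first by rewrite natrB.
  by rewrite ffact_small // !mul0r.
by rewrite -bin_ffact natrM mulfK // pnatr_eq0 -lt0n fact_gt0.
Qed.

(** The binomial theorem for the commuting operators x_{i+1,i} and D_i: for natural exponents eta is
    the action of E_{i+1,i}^c. *)
Lemma eta_nat i (c : nat) f : eta i c%:R f = iter c (lowerX i) f.
Proof.
have -> : iter c (lowerX i) f = eta_trunc i c%:R c.+1 f.
  pose T (c r : nat) := mulX i.+1 i (c%:R - r%:R) (iter r (Dop i) f).
  have -> : eta_trunc i c%:R c.+1 f = \sum_(r < c.+1) 'C(c, r)%:R *: T c r.
    by apply: eq_bigr => r _; rewrite eta_termE falling_nat.
  elim: c => [|c IH].
    by rewrite big_ord_recl big_ord0 addr0 bin0 scale1r /T subrr mulX0.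
  rewrite iterS IH /lowerX !raddf_sum /=.
  have XT r : mulX i.+1 i 1 (T c r) = T c.+1 r.
    rewrite /T mulXD; suff -> : 1 + (c%:R - r%:R) = c.+1%:R - r%:R :> C by [].
    by rewrite -[c.+1%:R]natr1; ring.
  have DT r : Dop i (T c r) = T c.+1 r.+1.
    rewrite /T Dop_mulX iterS.
    suff -> : c%:R - r%:R = c.+1%:R - r.+1%:R :> C by [].
    by rewrite -[c.+1%:R]natr1 -[r.+1%:R]natr1; ring.
  under eq_bigr do rewrite linearZ /= XT.
  under [X in _ + X]eq_bigr do rewrite linearZ /= DT.
  rewrite [in RHS]big_ord_recl /= bin0 scale1r.
  under [X in _ = _ + X]eq_bigr do rewrite /bump leq0n add1n binS natrD scalerDl.
  rewrite big_split /= addrA; congr (_ + _).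
  by rewrite big_ord_recl /= bin0 scale1r [in RHS]big_ord_recr /=
    bin_small // scale0r addr0.
apply/funext => e; rewrite /eta /eta_trunc series_sum.
rewrite (fsbig_ord _ c.+1 (fun r => eta_term i c%:R f r e)); apply/esym.
apply: fsbig_widen => // r [_ /= rc].
by rewrite eta_termE seriesZ falling_nat bin_small ?mul0r // ltnNge; apply/negP.
Qed.

Definition dominant_upto k m := forall i j, (0 < i < j)%N -> (j <= k.+1)%N ->
  exists c : nat, m i - m j = c%:R.

(** A move keeps the order of the entries that stay in the first places, so dominance persists. Each
    exponent m (i_p) - m (k + 1) has i_p < k + 1, hence is a natural number, and [eta_nat]
    applies. *)
Lemma theta_dominant idx (P : series C -> Prop) : (0 < n)%N -> admissible n idx ->
  dominant_upto n.-1 (fun k => Lam k - k%:R) ->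
  (forall i f, (0 < i < n)%N -> P f -> P (lowerX i f)) ->
  P (@one_series C) -> P (theta n lam idx).
Proof.
move=> n0 adm dom PX P1; rewrite /theta.
suff claim k m f : (k < n)%N -> lam_compat idx k m -> dominant_upto k m -> P f ->
    P (foldr (Bop n lam idx) f (iota 1 k)).
  apply: claim dom P1; first by lia.
  move=> j jn; rewrite /lam_at subnn /= -(glweight_root n lam) //; last by lia.
  by rewrite -natr1; ring.
elim: k m f => [//|k IH] m f kn H dm Pf; rewrite foldr_iotaS.
have ik : (idx k.+1 <= k.+1)%N by apply: adm; lia.
apply: (IH (move_last k.+1 (idx k.+1) m)); first by lia.
- exact: (lam_compat_pred (p := k.+1)).
- move=> i j ij jk; rewrite /move_last; case: eqP => i0; first by apply: dm; lia.
  by repeat case: ifP => ?; apply: dm; lia.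
apply: (Bop_ind (m := m) (P := fun _ => P)) => // d id dk g Pg.
have [c ->] := dm (idx k.+1) d.+1 ltac:(lia) ltac:(lia).
rewrite eta_nat; elim: c => //= c IHc; apply: PX => //; lia.
Qed.

End Theta.

(** * Counting the singular lines *)

Section SingularVectors.
Context {C : numFieldType} (n : nat) (lam : nat -> C).
Context (M : lmodType C) (act : 'M[C]_n -> M -> M) (v : M).
Hypothesis n_gt0 : (0 < n)%N.
Hypothesis hM : verma_module lam act v.
Context (tau : {linear M -> polyA C n}).
Hypothesis htau : forall alpha, tau (Epow act alpha v) = 'X_[alpha].
Implicit Types (u w : M) (s : 'S_n) (m t : nat -> C) (idx : nat -> nat).

Let hsl := verma_sl hM.
Local Notation E i j := (act (mxunit C n i j)).
Local Notation Lam := (glweight n lam).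
Local Notation S := (tau_series tau).
Local Notation rho_lam := (fun k => Lam k - k%:R).

Lemma singular_series_ext m t f : (forall k, (0 < k <= n)%N -> m k = t k) ->
  singular_series n Lam m f -> singular_series n Lam t f.
Proof.
move=> mt [fA fw fr fl]; split=> // [e fe k kn|].
  by rewrite -mt // (fw e fe k kn).
rewrite -fl; congr (f _); apply/funext => i; apply/funext => j; rewrite /lead_exp.
case: ifP => // /and3P[j0 jn _]; apply: eq_big_nat => k kj; rewrite mt //; lia.
Qed.

Definition perm_weight s k : C :=
  if insub k.-1 is Some i then rho_lam (s i).+1 else 0.

Lemma perm_weightE s (i : 'I_n) : perm_weight s i.+1 = rho_lam (s i).+1.
Proof. by rewrite /perm_weight /= valK. Qed.

Lemma map_iota1 (f : nat -> C) :
  map f (iota 1 n) = [tuple f i.+1 | i < n].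
Proof.
rewrite -[1%N]/(1 + 0)%N iotaDl -val_enum_ord -!map_comp /=.
by rewrite -enumT; apply: eq_map.
Qed.

Lemma perm_weight_perm s :
  perm_eq (map rho_lam (iota 1 n)) (map (perm_weight s) (iota 1 n)).
Proof.
rewrite perm_sym !map_iota1; apply/tuple_permP; exists s.
by congr (tval _); apply: eq_mktuple => i; rewrite tnth_mktuple perm_weightE.
Qed.

Lemma perm_weight_onto t : perm_eq (map rho_lam (iota 1 n)) (map t (iota 1 n)) ->
  exists s, forall k, (0 < k <= n)%N -> t k = perm_weight s k.
Proof.
rewrite perm_sym !map_iota1 => /tuple_permP[s E]; exists s => k kn.
have kp : (k.-1 < n)%N by lia.
have -> : k = (Ordinal kp).+1 by rewrite /=; lia.
rewrite perm_weightE; have /val_inj/(congr1 (fun x => tnth x (Ordinal kp))) := E.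
by rewrite !tnth_mktuple.
Qed.

Lemma theta_perm s : exists2 idx, admissible n idx &
  singular_series n Lam (perm_weight s) (theta n lam idx).
Proof.
have /moves_onto[idx [adm onto]] : perm_eq (map rho_lam (iota 1 n.-1.+1))
    (map (perm_weight s) (iota 1 n.-1.+1)) by rewrite prednK // perm_weight_perm.
have adm' : admissible n idx by move=> p pn; apply: adm; lia.
exists idx => //; apply: singular_series_ext (theta_singular _ n_gt0 adm').
by move=> k kn; apply: onto; lia.
Qed.

(** With 0 included this is a line or {0}. It depends on s only through the weight, so different
    permutations may share a space. *)
Definition singular_space s : set M := [set u |
  has_weight n Lam (fun k => perm_weight s k + k%:R) (S u) /\
  forall i, (0 < i < n)%N -> E i i.+1 u = 0].

Lemma tau_singular_series m f u : singular_series n Lam m f ->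
  has_weight n Lam (fun k => m k + k%:R) (S u) ->
  (forall i, (0 < i < n)%N -> E i i.+1 u = 0) ->
  S u = S u (lead_exp n Lam m) *: f.
Proof.
move=> fs uw u0; apply: singular_series_uniq fs _ uw _.
  exact: series_of_poly_A0.
by move=> l ln; rewrite -(tau_raise n_gt0 hM htau) // u0 // raddf0.
Qed.

Lemma tau_singular_vector m u : singular_series n Lam m (S u) ->
  singular_vector act u.
Proof.
move=> [_ uw ur ul]; split.
- apply: contraTneq isT => u0; move: ul; rewrite u0 raddf0 series0 => /eqP.
  by rewrite eq_sym oner_eq0.
- by have wv := tau_weight_vector n_gt0 hM htau uw; eexists; exact: wv.
- move=> i iN; apply: (tau_series_inj hM htau).
  by rewrite (tau_raise n_gt0 hM htau) // ur // raddf0.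
Qed.

(** The invariants have the same eigenvalues on u as on v, so [gelfand_eigen_perm] compares the
    numbers m a + n - a; subtracting n gives the rho-shifted weights. *)
Lemma singular_in_space u : singular_vector act u ->
  exists s, singular_space s u.
Proof.
case=> u0 [mu uw] us.
have /perm_weight_onto[s ms] :
    perm_eq (map rho_lam (iota 1 n)) (map (fun k => glweight n mu k - k%:R) (iota 1 n)).
  have := gelfand_eigen_perm (fun k => singular_casimir n_gt0 hM k u0 uw us).
  move/(perm_map (fun x => x - n%:R)); rewrite -!map_comp /index_iota subn1 /=.
  congr perm_eq; apply/eq_in_map => k; rewrite mem_iota => kn /=;
    rewrite natrB; try lia; ring.
exists s; split=> // e ue k kn.
by rewrite -ms // subrK (singular_tau_weight n_gt0 hM htau uw).
Qed.

Lemma singular_space_line s u : singular_space s u -> u != 0 ->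
  singular_space s = line u.
Proof.
move=> [uw us] u0; have [idx _ fs] := theta_perm s.
have Su := tau_singular_series fs uw us; set c := S u _ in Su.
have c0 : c != 0.
  apply: contra_neq u0 => c0; apply: (tau_series_inj hM htau).
  by rewrite Su c0 scale0r raddf0.
apply/seteqP; split=> [w [ww ws]|_ [d _ <-]].
  exists (S w (lead_exp n Lam (perm_weight s)) / c) => //.
  apply: (tau_series_inj hM htau); rewrite linearZ /= Su scalerA divfK //.
  by rewrite -(tau_singular_series fs ww ws).
split=> [e|i iN].
  by rewrite linearZ /= seriesZ mulf_eq0 negb_or => /andP[_ /uw].
have EL : linear (E i i.+1).
  by apply: (@E_linear _ _ _ _ hsl (i, i.+1)); rewrite /is_root /=; lia.
have E0 : E i i.+1 0 = 0.
  by have := EL (-1) 0 0; rewrite scaler0 addr0 scaleN1r addNr.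
by have := EL d u 0; rewrite !addr0 us // E0 scaler0 addr0.
Qed.

Lemma space_singular s u : singular_space s u -> u != 0 -> singular_vector act u.
Proof.
move=> [uw us] u0; split=> //.
by have wv := tau_weight_vector n_gt0 hM htau uw; eexists; exact: wv.
Qed.

Lemma singular_vector_theta u : singular_vector act u ->
  exists idx w c, [/\ admissible n idx, S w = theta n lam idx, c != 0 & u = c *: w].
Proof.
move=> us; have u0 : u != 0 by case: us.
have [s [uw ur]] := singular_in_space us.
have [idx adm fs] := theta_perm s.
have Su := tau_singular_series fs uw ur; set c := S u _ in Su.
have c0 : c != 0.
  apply: contra_neq u0 => c0; apply: (tau_series_inj hM htau).
  by rewrite Su c0 scale0r raddf0.
exists idx, (c^-1 *: u), c; split=> //.
  by rewrite linearZ /= Su scalerA mulVf // scale1r.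
by rewrite scalerA mulfV // scale1r.
Qed.

Lemma theta_singular_vector idx w : admissible n idx -> S w = theta n lam idx ->
  singular_vector act w.
Proof.
move=> adm Sw; apply: tau_singular_vector.
by rewrite Sw; exact: theta_singular.
Qed.

Lemma lineZ c w : c != 0 -> line (c *: w) = line w.
Proof.
move=> c0; apply/seteqP; split=> _ [d _ <-].
  by exists (d * c) => //; rewrite scalerA.
by exists (d / c) => //; rewrite scalerA divfK.
Qed.

Lemma singular_lines_spaces : singular_lines act =
  singular_space @` [set s | exists2 u, singular_space s u & u != 0].
Proof.
apply/seteqP; split=> [_ [u us <-]|_ [s [u us u0] <-]].
  have [s su] := singular_in_space us; have u0 : u != 0 by case: us.
  by exists s; [exists u|exact: singular_space_line].
exists u; first exact: space_singular us u0.
by rewrite (singular_space_line us u0).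
Qed.

Lemma card_perm_II : ([set: 'S_n] #= `I_(n`!))%card.
Proof.
have -> : n`! = #|{perm 'I_n}| by rewrite card_Sn.
rewrite (card_eqr card_II) card_eq_sym.
have <- : enum_rank @` [set: 'S_n] = [set: 'I_#|{perm 'I_n}|].
  by apply/seteqP; split=> // i _; exists (enum_val i); rewrite ?enum_valK.
by apply: inj_card_eq => x y _ _; exact: enum_rank_inj.
Qed.

Lemma card_singular_lines_le : (singular_lines act #<= `I_(n`!))%card.
Proof.
rewrite singular_lines_spaces; apply: card_le_trans (card_image_le _ _) _.
by rewrite -(card_le_eqr card_perm_II); apply: subset_card_le.
Qed.

Lemma rho_lam_diff i : (0 < i)%N -> rho_lam i - rho_lam i.+1 = lam i + 1.
Proof.
by move=> i0; rewrite -(glweight_root n lam) // -natr1; ring.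
Qed.

(** Strict positivity comes from rho. It makes the n numbers distinct, so distinct permutations have
    distinct weights. *)
Lemma dominant_rho_lam : dominant_integral n lam ->
  forall i j, (0 < i < j)%N -> (j <= n)%N -> exists c : nat,
    rho_lam i - rho_lam j = c.+1%:R.
Proof.
move=> dom i j ij jn; have -> : j = (i + (j - i).-1).+1 by lia.
have : (i + (j - i).-1 < n)%N by lia.
elim: (j - i).-1 => [|d IH] dn.
  have [k kE] := dom i ltac:(lia); exists k.
  by rewrite addn0 rho_lam_diff ?kE ?natr1 //; lia.
have [c ce] := IH ltac:(lia); have [k kE] := dom (i + d).+1 ltac:(lia).
exists (c.+1 + k)%N; rewrite -[(_ + k).+1]addnS [RHS]natrD -ce addnS.
rewrite -[k.+1%:R]natr1 -kE.
by rewrite -rho_lam_diff //; ring.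
Qed.

Lemma dominant_theta : dominant_integral n lam ->
  forall idx, admissible n idx -> exists w, S w = theta n lam idx.
Proof.
move=> dom idx adm; apply: (theta_dominant (P := fun f => exists w, S w = f)) => //.
- move=> i j ij jn; have [c ->] := dominant_rho_lam dom ij ltac:(lia).
  by exists c.+1.
- by move=> i _ iN [w <-]; exists (E i.+1 i w); rewrite (tau_lower n_gt0 hM htau).
- by exists v; rewrite (tau_v htau).
Qed.

Lemma singular_space_inj s s' u : u != 0 ->
  singular_space s u -> singular_space s' u ->
  forall k, (0 < k <= n)%N -> perm_weight s k = perm_weight s' k.
Proof.
move=> u0 [uw _] [uw' _] k kn.
have [e ue] : exists e, S u e != 0.
  apply: contrapT => nex; move/eqP: u0; apply; apply: (tau_series_inj hM htau).
  rewrite raddf0; apply/funext => e; rewrite series0.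
  by apply: contrapT => /eqP ue; apply: nex; exists e.
by apply: (addIr k%:R); rewrite -(uw e ue k kn) (uw' e ue k kn).
Qed.

Lemma dominant_perm_weight_inj s s' : dominant_integral n lam ->
  (forall k, (0 < k <= n)%N -> perm_weight s k = perm_weight s' k) -> s = s'.
Proof.
move=> dom ss; apply/permP => i; apply/val_inj.
have := ss i.+1 (ltn_ord i); rewrite !perm_weightE => E.
have ne (a b : 'I_n) : rho_lam a.+1 = rho_lam b.+1 -> ~ (a < b)%N.
  move=> ab lt; have [c] := dominant_rho_lam dom (i := a.+1) (j := b.+1) lt (ltn_ord b).
  by rewrite ab subrr => /eqP; rewrite eq_sym pnatr_eq0.
by case: (ltngtP (s i) (s' i)) => // [/(ne _ _ E)|/(ne _ _ (esym E))].
Qed.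

Lemma dominant_space s : dominant_integral n lam ->
  exists2 u, singular_space s u & u != 0.
Proof.
move=> dom; have [idx adm fs] := theta_perm s.
have [w Sw] := dominant_theta dom adm.
have [w0 _ ws] := theta_singular_vector adm Sw.
by exists w => //; split=> //; rewrite Sw; exact: ss_weight fs.
Qed.

Lemma dominant_card : dominant_integral n lam ->
  (singular_lines act #= `I_(n`!))%card.
Proof.
move=> dom; rewrite -(card_eqr card_perm_II) singular_lines_spaces.
have -> : [set s | exists2 u, singular_space s u & u != 0] = [set: 'S_n].
  by apply/seteqP; split=> // s _; exact: dominant_space.
apply: inj_card_eq => s s' _ _ E; have [u us u0] := dominant_space s dom.
apply: dominant_perm_weight_inj dom (singular_space_inj u0 us _).
by rewrite -E.
Qed.

(* The lines inject into the permutations, so if there are n! of them then every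
   permutation occurs, exactly once. *)
Lemma card_singular_full : (singular_lines act #= `I_(n`!))%card ->
  (forall s, exists2 u, singular_space s u & u != 0) /\
  forall s s', singular_space s = singular_space s' -> s = s'.
Proof.
rewrite card_eq_sym => /card_set_bijP[F [Ffun Finj _]].
have FG (i : 'I_(n`!)) : exists s, F i = singular_space s /\
    exists2 u, singular_space s u & u != 0.
  have : singular_lines act (F i) by apply: Ffun; exact: ltn_ord.
  by rewrite singular_lines_spaces => -[s su <-]; exists s.
pose h (i : 'I_(n`!)) := xget 1%g [set s | F i = singular_space s /\
    exists2 u, singular_space s u & u != 0].
have hP (i : 'I_(n`!)) : F i = singular_space (h i) /\
    exists2 u, singular_space (h i) u & u != 0.
  by rewrite /h; case: xgetP => [s -> //|]; have [s sP] := FG i; move/(_ s).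
have hinj : injective h.
  move=> i j hij; apply/val_inj; apply: Finj; rewrite ?inE //=; try exact: ltn_ord.
  by rewrite (hP i).1 (hP j).1 hij.
have [h' _ hh'] : bijective h.
  by apply: inj_card_bij hinj _; rewrite card_ord card_Sn.
split=> [s|s s' ss]; first by rewrite -(hh' s); exact: (hP _).2.
rewrite -(hh' s) -(hh' s'); congr (h _); apply/val_inj; apply: Finj;
  rewrite ?inE //=; try exact: ltn_ord.
by rewrite (hP _).1 (hP (h' s')).1 !hh'.
Qed.

(** The transposition (i, i + 1) occurs, and the leading monomial of its singular vector is
    x_{i+1,i}^(lambda_i + 1), which must be an honest monomial. *)
Lemma card_dominant : (singular_lines act #= `I_(n`!))%card ->
  dominant_integral n lam.
Proof.
move=> /card_singular_full[occur sinj] i iN.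
have ip : (i.-1 < n)%N by lia.
have iq : (i < n)%N by lia.
pose a := Ordinal ip; pose b := Ordinal iq; pose s : 'S_n := tperm a b.
have aE : a.+1 = i by rewrite /= prednK //; lia.
have [u us u0] := occur s; have [uw ur] := us.
have [idx _ fs] := theta_perm s.
have : S u (lead_exp n Lam (perm_weight s)) != 0.
  apply: contra_neq u0 => c0; apply: (tau_series_inj hM htau).
  by rewrite (tau_singular_series fs uw ur) c0 scale0r raddf0.
case/series_of_poly_supp=> alpha /(congr1 (fun e => e i.+1 i)).
have sk k : (0 < k <= n)%N -> k != i -> k != i.+1 -> perm_weight s k = rho_lam k.
  move=> kn ki ki1; have kp : (k.-1 < n)%N by lia.
  have kE : (Ordinal kp).+1 = k by rewrite /= prednK //; lia.
  rewrite -[in LHS]kE perm_weightE tpermD ?kE // -val_eqE /=; lia.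
have si : perm_weight s i = rho_lam i.+1 by rewrite -[in LHS]aE perm_weightE tpermL.
have si1 : perm_weight s i.+1 = rho_lam i.
  by rewrite -[i.+1]/(b.+1) perm_weightE tpermR aE.
have i0 : (0 < i)%N by case/andP: iN.
rewrite /lead_exp eqxx i0 iq /expo_mnm big_nat_recr //= big_nat big1 ?add0r; last first.
  by move=> k ki; rewrite sk ?subrr //; lia.
rewrite si rho_lam_diff //; case: (mexp alpha i.+1 i) => [|c] /eqP; last first.
  by rewrite -natr1 -subr_eq0 opprD addrACA subrr addr0 subr_eq0 => /eqP ->; exists c.
(* Exponent 0 would mean that s fixes the weight, so that s and 1 would share a line, against
   injectivity. *)
rewrite -rho_lam_diff // subr_eq0 => /eqP rE.
have s1 k : (0 < k <= n)%N -> perm_weight s k = perm_weight 1%g k.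
  move=> kn; have kp : (k.-1 < n)%N by lia.
  have -> : perm_weight 1%g k = rho_lam k.
    have kE : (Ordinal kp).+1 = k by rewrite /= prednK //; lia.
    by rewrite -[in LHS]kE perm_weightE perm1 kE.
  have [->|ki] := eqVneq k i; first by rewrite si.
  have [->|ki1] := eqVneq k i.+1; first by rewrite si1.
  exact: sk.
have /sinj/permP/(_ a) : singular_space s = singular_space 1%g.
  apply/seteqP; split=> w [ww ws]; split=> // e we k kn.
    by rewrite -s1 // (ww e we).
  by rewrite s1 // (ww e we).
rewrite tpermL perm1 => /(congr1 val) /=; lia.
Qed.

End SingularVectors.

Theorem corollary3p4 (R : realType) (n : nat) (hn : (2 <= n)%N)
    (lam : nat -> R[i]) (M : lmodType R[i]) (act : 'M[R[i]]_n -> M -> M) (v : M)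
    (hM : verma_module lam act v)
    (tau : {linear M -> polyA R[i] n})
    (htau : forall alpha, tau (Epow act alpha v) = 'X_[alpha]) :
  [/\ (singular_lines act #<= `I_(n`!))%card,
      forall u : M, singular_vector act u ->
        exists (idx : nat -> nat) (w : M) (c : R[i]),
          [/\ admissible n idx, series_of_poly (tau w) = theta n lam idx
            & u = c *: w],
      (singular_lines act #= `I_(n`!))%card <-> dominant_integral n lam
    & dominant_integral n lam ->
        (forall idx : nat -> nat, admissible n idx ->
           exists2 w : M, series_of_poly (tau w) = theta n lam idx
                        & singular_vector act w)
        /\ singular_lines act =
             [set line w | w in [set w : M | exists2 idx : nat -> nat,
                admissible n idx
                & series_of_poly (tau w) = theta n lam idx]]].
Proof.
have n_gt0 : (0 < n)%N by lia.
split.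
- exact: (@card_singular_lines_le R[i] n lam M act v n_gt0 hM tau htau).
- move=> u us.
  have [idx [w [c [adm Sw _ uw]]]] :=
    @singular_vector_theta R[i] n lam M act v n_gt0 hM tau htau u us.
  by exists idx, w, c.
- split; first exact: (@card_dominant R[i] n lam M act v n_gt0 hM tau htau).
  exact: (@dominant_card R[i] n lam M act v n_gt0 hM tau htau).
have theta_sing := @theta_singular_vector R[i] n lam M act v n_gt0 hM tau htau.
move=> dom; split=> [idx adm|].
  have [w Sw] := @dominant_theta R[i] n lam M act v n_gt0 hM tau htau dom idx adm.
  by exists w => //; exact: theta_sing adm Sw.
apply/seteqP; split=> _ [u us <-].
  have [idx [w [c [adm Sw c0 ->]]]] :=
    @singular_vector_theta R[i] n lam M act v n_gt0 hM tau htau u us.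
  by rewrite lineZ //; exists w => //; exists idx.
by case: us => idx adm Sw; exists u => //; exact: theta_sing adm Sw.
Qed.
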